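(* Let $a_1\in\mathbb D$, $a_1'=|1+a_1|-1$, $\gamma_{a_1}=\arg(1+\overline{a_1})$, $0\le\gamma_1,\gamma_2<2\pi$, and let $f_1=h_1+\overline{g_1}\in\mathcal S(H^{a_1}_{\gamma_1})$ with $h_1(z)+e^{-2i(\gamma_1+\gamma_{a_1})}g_1(z)=\frac{(1+a_1')z}{1-e^{i(\gamma_1+\gamma_{a_1})}z}$ and dilatation $$\omega_{f_1}(z)=e^{2i(\gamma_1+\gamma_{a_1})}\frac{a_1'-ze^{i(\gamma_1+\gamma_{a_1})}}{1-a_1'ze^{i(\gamma_1+\gamma_{a_1})}}.$$ Let $f_2=h_2+\overline{g_2}$ be locally univalent with dilatation $\omega_{f_2}(z)=e^{i\theta}z^n$, where $n$ is a positive integer and $\theta\in\mathbb R$. Assume $|1+a_1|\in[\frac{2n}{n+2},2)$. (1) If $f_2\in\mathcal S(H^0_{\gamma_2})$ with $h_2(z)+e^{-2i\gamma_2}g_2(z)=\frac{z}{1-e^{i\gamma_2}z}$, then $f_1*f_2$ is univalent and convex in the direction $-(\gamma_1+\gamma_{a_1}+\gamma_2)$. (2) If $f_2\in\mathcal S(\Omega^0_\beta)$ for some $0<\beta<\pi$, with $h_2(z)+g_2(z)=\frac{1}{2i\sin\beta}\log\left(\frac{1+ze^{i\beta}}{1+ze^{-i\beta}}\right)$, then $f_1*f_2$ is univalent and convex in the direction $-(\gamma_1+\gamma_{a_1})$.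
   Context: $\mathbb D$ is the open unit disk. Harmonic $f=h+\overline g$ on $\mathbb D$ ($h,g$ analytic, $g(0)=0$), dilatation $\omega_f=g'/h'$; $\mathcal H$: those with $h(0)=g(0)=0$, $h'(0)=1$; $\mathcal S_H$: sense-preserving ($|h'|>|g'|$) univalent members of $\mathcal H$. $H^a_\gamma=\{w:\mathrm{Re}(\frac{e^{i\gamma}}{1+a}w)>-\frac12\}$, $\mathcal S(H^a_\gamma)=\{f\in\mathcal S_H:f(\mathbb D)=H^a_\gamma\}$; $\Omega^0_\beta=\{w:\frac{\beta-\pi}{2\sin\beta}<\mathrm{Re}\,w<\frac{\beta}{2\sin\beta}\}$, $\mathcal S(\Omega^0_\beta)=\{f\in\mathcal S_H:f(\mathbb D)=\Omega^0_\beta\}$. Harmonic convolution: $f*F=\sum a_nA_nz^n+\sum\overline{b_nB_n}\,\overline z^n$ for $f=\sum a_nz^n+\sum\overline{b_n}\,\overline z^n$, $F=\sum A_nz^n+\sum\overline{B_n}\,\overline z^n$. A univalent map $f$ is convex in the direction $\alpha$ (modulo $\pi$) if each line parallel to the line through $0$ and $e^{i\alpha}$ meets $f(\mathbb D)$ in an interval or the empty set. Logarithms are principal branches vanishing at $0$. *)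

(* Defs.v *)
From Stdlib Require Import Reals ClassicalEpsilon.
Open Scope R_scope.

Definition Cx : Type := (R * R)%type.
Definition RtoC (x : R) : Cx := (x, 0).
Definition Czero : Cx := (0, 0).
Definition Cone : Cx := (1, 0).
Definition Ci : Cx := (0, 1).
Definition Cre (z : Cx) : R := fst z.
Definition Cim (z : Cx) : R := snd z.
Definition Cadd (z w : Cx) : Cx := (fst z + fst w, snd z + snd w).
Definition Copp (z : Cx) : Cx := (- fst z, - snd z).
Definition Csub (z w : Cx) : Cx := Cadd z (Copp w).
Definition Cmul (z w : Cx) : Cx :=
  (fst z * fst w - snd z * snd w, fst z * snd w + snd z * fst w).
Definition Cconj (z : Cx) : Cx := (fst z, - snd z).
Definition Cmod (z : Cx) : R := sqrt (fst z ^ 2 + snd z ^ 2).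
Definition Cinv (z : Cx) : Cx :=
  (fst z / (fst z ^ 2 + snd z ^ 2), - snd z / (fst z ^ 2 + snd z ^ 2)).
Definition Cdiv (z w : Cx) : Cx := Cmul z (Cinv w).
Fixpoint Cpow (z : Cx) (n : nat) : Cx :=
  match n with O => Cone | S m => Cmul z (Cpow z m) end.
Definition Cexpi (t : R) : Cx := (cos t, sin t).

Definition Carg (z : Cx) : R :=
  let x := fst z in let y := snd z in
  if Rlt_dec 0 x then atan (y / x)
  else if Rlt_dec x 0 then
    (if Rle_dec 0 y then atan (y / x) + PI else atan (y / x) - PI)
  else if Rlt_dec 0 y then PI / 2
  else if Rlt_dec y 0 then - (PI / 2) else 0.

Definition Clog (z : Cx) : Cx := (ln (Cmod z), Carg z).

Definition inD (z : Cx) : Prop := Cmod z < 1.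

Fixpoint psum (a : nat -> Cx) (z : Cx) (n : nat) : Cx :=
  match n with
  | O => a O
  | S m => Cadd (psum a z m) (Cmul (a (S m)) (Cpow z (S m)))
  end.

Definition has_sum (a : nat -> Cx) (z : Cx) (s : Cx) : Prop :=
  forall eps, 0 < eps -> exists N, forall n, (N <= n)%nat ->
    Cmod (Csub (psum a z n) s) < eps.

Definition ps_on_D (a : nat -> Cx) : Prop :=
  forall z, inD z -> exists s, has_sum a z s.

(** value of the power series (meaningful where it converges) *)
Definition Cps (a : nat -> Cx) (z : Cx) : Cx :=
  epsilon (inhabits Czero) (fun s => has_sum a z s).

Definition Cderiv (F : Cx -> Cx) (z l : Cx) : Prop :=
  forall eps, 0 < eps -> exists del, 0 < del /\ forall w,
    0 < Cmod (Csub w z) < del ->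
    Cmod (Csub (Cdiv (Csub (F w) (F z)) (Csub w z)) l) < eps.

(** * Harmonic maps f = h + conj g, h = sum a_n z^n, g = sum b_n z^n *)
Definition hfun (a b : nat -> Cx) (z : Cx) : Cx := Cadd (Cps a z) (Cconj (Cps b z)).

Definition hconv (a A : nat -> Cx) : nat -> Cx := fun n => Cmul (a n) (A n).

Definition univalent_D (F : Cx -> Cx) : Prop :=
  forall z w, inD z -> inD w -> F z = F w -> z = w.

Definition locally_univalent_D (F : Cx -> Cx) : Prop :=
  forall z, inD z -> exists r, 0 < r /\
    forall u v, inD u -> inD v -> Cmod (Csub u z) < r -> Cmod (Csub v z) < r ->
      F u = F v -> u = v.

Definition dilatation_is (a b : nat -> Cx) (om : Cx -> Cx) : Prop :=
  forall z, inD z -> exists hd gd,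
    Cderiv (Cps a) z hd /\ Cderiv (Cps b) z gd /\ hd <> Czero /\ Cdiv gd hd = om z.

Definition sense_preserving (a b : nat -> Cx) : Prop :=
  forall z, inD z -> exists hd gd,
    Cderiv (Cps a) z hd /\ Cderiv (Cps b) z gd /\ Cmod gd < Cmod hd.

Definition harmonic_D (a b : nat -> Cx) : Prop :=
  ps_on_D a /\ ps_on_D b /\ b O = Czero.

Definition class_SH (a b : nat -> Cx) : Prop :=
  harmonic_D a b /\ a O = Czero /\ Cderiv (Cps a) Czero Cone /\
  sense_preserving a b /\ univalent_D (hfun a b).

Definition class_S (Om : Cx -> Prop) (a b : nat -> Cx) : Prop :=
  class_SH a b /\ forall w, Om w <-> exists z, inD z /\ hfun a b z = w.

Definition Hhalf (a : Cx) (gam : R) (w : Cx) : Prop :=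
  Cre (Cmul (Cdiv (Cexpi gam) (Cadd Cone a)) w) > - (1 / 2).

Definition Omega0 (beta : R) (w : Cx) : Prop :=
  (beta - PI) / (2 * sin beta) < Cre w < beta / (2 * sin beta).

(** univalent and convex in direction alpha: every line parallel to e^{i alpha}
    meets F(D) in an interval (convex subset of the line) or the empty set *)
Definition convex_in_direction (F : Cx -> Cx) (alpha : R) : Prop :=
  univalent_D F /\
  forall w1 t, (exists z, inD z /\ F z = w1) ->
    (exists z, inD z /\ F z = Cadd w1 (Cmul (RtoC t) (Cexpi alpha))) ->
    forall s, 0 <= s <= 1 ->
      exists z, inD z /\ F z = Cadd w1 (Cmul (RtoC (s * t)) (Cexpi alpha)).

(* Main.v *)
(** Convolving with the half-plane map [f1] multiplies coefficients by affine
    functions of the index, so with [a := |1 + a1| - 1] and [u := e^(i phi) z]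
    the map [f1 * f2] is, up to a constant factor,
    [(1+a) h2(u) + (1-a) u h2'(u) + conj ((1+a) g2(u) - (1-a) u g2'(u))].
    After a rotation [h2' + g2'] is the derivative of a conformal map of the disk
    onto a half-plane or a strip. In the coordinate [w] of that convex domain, the
    difference of the analytic and co-analytic parts has a derivative whose real
    part is bounded below by a positive function of [Re w] alone, so the level
    curves of the imaginary part are graphs over the whole interval of abscissae.
    The condition on [|1 + a1|] makes the map sense-preserving, hence its real part
    strictly increases along these curves: this yields univalence and convexity in
    the direction of the real axis at once. *)

From Stdlib Require Import Reals Lra Lia ClassicalEpsilon.
From Coquelicot Require Import Coquelicot.
Require Import Defs.
Open Scope R_scope.

(* The point is to reach univalence without boundary values. With [Psi = H - G], it is enough that
   on each vertical line [Im Psi] grows at a rate bounded below by a positive constant of that line: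
   it then takes every real value exactly once there. Positivity of the rate alone would not
   suffice, and in the disk vertical chords are bounded. Hence the passage to coordinates in which
   the domain is a union of full vertical lines. There [Psi'] is a positive multiple of
   [(1 + a) (1 - om) / (1 + om) + (1 - a) P], where [om] is the dilatation of the rotated second map
   and [P = (1 - v^2) / quad c v]. The first term has positive real part because [|om| < 1]; the
   second equals [1 + 2 w] on the half-plane and [- sin w / sin b] on the strip, whose real parts
   are bounded below in terms of [Re w] only. The exponent [n] comes in through [v om' = n om],
   since the convolution differentiates the second map. The dilatation of the result is
   [om (d - Z) / (d + Z)] with [Re Z > 0], of modulus below 1 once [d >= 0]. *)
Declare Scope Cx_scope.
Delimit Scope Cx_scope with X.
Notation "x + y" := (Cadd x y) : Cx_scope.
Notation "x - y" := (Csub x y) : Cx_scope.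
Notation "x * y" := (Cmul x y) : Cx_scope.
Notation "x / y" := (Cdiv x y) : Cx_scope.
Notation "- x" := (Copp x) : Cx_scope.
Notation "x ^ n" := (Cpow x n) : Cx_scope.
Notation "0" := Czero : Cx_scope.
Notation "1" := Cone : Cx_scope.

(** * Complex arithmetic *)

(** The operations on [Cx] unfold to Coquelicot's operations on [C], so algebraic and modulus facts
    transfer by conversion. *)
Lemma Cx_field_theory :
  field_theory Czero Cone Cadd Cmul Csub Copp Cdiv Cinv eq.
Proof. exact C_field_theory. Qed.

Lemma Cx_power_theory :
  Ring_theory.power_theory Cone Cmul eq BinNat.N.to_nat Cpow.
Proof. exact C_power_theory. Qed.

Lemma Cx_ring_morph :
  Ring_theory.ring_morph Czero Cone Cadd Cmul Csub Copp eq
    0%Z 1%Z Z.add Z.mul Z.sub Z.opp Z.eqb (fun z => RtoC (IZR z)).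
Proof. exact C_ring_morph. Qed.

Ltac Cx_cst t :=
  match t with
  | Czero => constr:(0%Z)
  | Cone => constr:(1%Z)
  | RtoC ?r =>
      match r with
      | R0 => constr:(0%Z)
      | R1 => constr:(1%Z)
      | IZR ?z => match isZcst z with true => z | _ => NotConstant end
      | _ => NotConstant
      end
  | _ => NotConstant
  end.

Add Field Cx_field : Cx_field_theory
  (morphism Cx_ring_morph, constants [Cx_cst],
   power_tac Cx_power_theory [Rpow_tac]).

Lemma Cx_ext (z w : Cx) : fst z = fst w -> snd z = snd w -> z = w.
Proof. destruct z, w; simpl; congruence. Qed.

Lemma RtoC_add x y : RtoC (x + y) = (RtoC x + RtoC y)%X.
Proof. apply Cx_ext; simpl; ring. Qed.

Lemma RtoC_mul x y : RtoC (x * y) = (RtoC x * RtoC y)%X.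
Proof. apply Cx_ext; simpl; ring. Qed.

Lemma RtoC_sub x y : RtoC (x - y) = (RtoC x - RtoC y)%X.
Proof. apply Cx_ext; simpl; ring. Qed.

Lemma RtoC_neq_0 x : x <> 0 -> RtoC x <> 0%X.
Proof. intros H E. apply H. exact (f_equal fst E). Qed.

Lemma Cmod_ge_0 z : 0 <= Cmod z.
Proof. exact (Complex.Cmod_ge_0 z). Qed.

Lemma Cmod_mul z w : Cmod (z * w)%X = Cmod z * Cmod w.
Proof. exact (Cmod_mult z w). Qed.

Lemma Cmod_add_le z w : Cmod (z + w)%X <= Cmod z + Cmod w.
Proof. exact (Cmod_triangle z w). Qed.

Lemma Cmod_opp z : Cmod (- z)%X = Cmod z.
Proof. exact (Complex.Cmod_opp z). Qed.

Lemma Cmod_sub_le z w : Cmod (z - w)%X <= Cmod z + Cmod w.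
Proof. rewrite <- (Cmod_opp w). apply Cmod_add_le. Qed.

Lemma Cmod_sub_sym z w : Cmod (z - w)%X = Cmod (w - z)%X.
Proof. rewrite <- Cmod_opp. f_equal. ring. Qed.

Lemma Cmod_sub_ge z w : Cmod z - Cmod w <= Cmod (z - w)%X.
Proof.
  pose proof (Cmod_add_le (z - w)%X w) as H.
  replace (z - w + w)%X with z in H by ring. lra.
Qed.

Lemma Cmod_zero : Cmod 0%X = 0.
Proof. exact Cmod_0. Qed.

Lemma Cmod_one : Cmod 1%X = 1.
Proof. exact Cmod_1. Qed.

Lemma Cmod_RtoC x : Cmod (RtoC x) = Rabs x.
Proof. exact (Cmod_R x). Qed.

Lemma Cmod_pos z : z <> 0%X -> 0 < Cmod z.
Proof. exact (proj1 (Cmod_gt_0 z)). Qed.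

Lemma Cmod_pos_neq z : 0 < Cmod z -> z <> 0%X.
Proof. exact (proj2 (Cmod_gt_0 z)). Qed.

Lemma Cmod_le_0 z : Cmod z <= 0 -> z = 0%X.
Proof.
  intros H. apply (Cmod_eq_0 z).
  apply Rle_antisym; [exact H | apply Cmod_ge_0].
Qed.

Lemma Cmod_Cinv z : z <> 0%X -> Cmod (Cinv z) = / Cmod z.
Proof. exact (Cmod_inv z). Qed.

Lemma Cmod_Cdiv z w : w <> 0%X -> Cmod (z / w)%X = Cmod z / Cmod w.
Proof. exact (Cmod_div z w). Qed.

Lemma Cmod_Cpow z n : Cmod (z ^ n)%X = Cmod z ^ n.
Proof. exact (Cmod_pow z n). Qed.

Lemma Cmod_sq z : Cmod z ^ 2 = fst z ^ 2 + snd z ^ 2.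
Proof. exact (Cmod2_alt z). Qed.

Lemma Cmod_fst z : Rabs (fst z) <= Cmod z.
Proof. exact (re_le_Cmod z). Qed.

Lemma Cmod_snd z : Rabs (snd z) <= Cmod z.
Proof.
  eapply Rle_trans; [|exact (Rmax_Cmod z)]. apply Rmax_r.
Qed.

Lemma Cmod_le_abs z : Cmod z <= Rabs (fst z) + Rabs (snd z).
Proof.
  replace z with (RtoC (fst z) + Ci * RtoC (snd z))%X at 1
    by (apply Cx_ext; simpl; ring).
  eapply Rle_trans; [apply Cmod_add_le|].
  rewrite Cmod_mul, !Cmod_RtoC. change (Cmod Ci) with (Complex.Cmod Complex.Ci).
  rewrite Cmod_Ci. lra.
Qed.

Lemma Cmod_lt_sq z w :
  fst z ^ 2 + snd z ^ 2 < fst w ^ 2 + snd w ^ 2 -> Cmod z < Cmod w.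
Proof.
  intros H. apply sqrt_lt_1_alt. split; [nra | exact H].
Qed.

Lemma Cmod_lt_sq_inv z w :
  Cmod z < Cmod w -> fst z ^ 2 + snd z ^ 2 < fst w ^ 2 + snd w ^ 2.
Proof.
  intros H. rewrite <- !Cmod_sq. pose proof (Cmod_ge_0 z). nra.
Qed.

Lemma Cmul_integral z w : (z * w)%X = 0%X -> z <> 0%X -> w = 0%X.
Proof.
  intros H Hz. replace w with (z * w / z)%X by (field; exact Hz).
  rewrite H. field. exact Hz.
Qed.

Lemma Csub_eq_0 z w : (z - w)%X = 0%X -> z = w.
Proof.
  intros H. replace z with (z - w + w)%X by ring. rewrite H. ring.
Qed.

Lemma Cexpi_add s t : Cexpi (s + t) = (Cexpi s * Cexpi t)%X.
Proof.
  unfold Cexpi. rewrite cos_plus, sin_plus. apply Cx_ext; simpl; ring.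
Qed.

Lemma Cexpi_0 : Cexpi 0 = 1%X.
Proof. unfold Cexpi. now rewrite cos_0, sin_0. Qed.

Lemma Cmod_Cexpi t : Cmod (Cexpi t) = 1.
Proof.
  unfold Cmod, Cexpi; simpl fst; simpl snd.
  replace (cos t ^ 2 + sin t ^ 2) with 1; [apply sqrt_1|].
  pose proof (sin2_cos2 t) as H. unfold Rsqr in H. lra.
Qed.

Lemma Cexpi_neq_0 t : Cexpi t <> 0%X.
Proof. apply Cmod_pos_neq. rewrite Cmod_Cexpi. lra. Qed.

Lemma Cexpi_opp t : Cexpi (- t) = Cinv (Cexpi t).
Proof.
  pose proof (Cexpi_neq_0 t).
  assert (E : (Cexpi (- t) * Cexpi t)%X = 1%X).
  { rewrite <- Cexpi_add, Rplus_opp_l. apply Cexpi_0. }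
  replace (Cexpi (- t)) with (Cexpi (- t) * Cexpi t * Cinv (Cexpi t))%X
    by (field; assumption).
  rewrite E. ring.
Qed.

Lemma Cexpi_double t : Cexpi (2 * t) = (Cexpi t * Cexpi t)%X.
Proof. rewrite <- Cexpi_add. f_equal. ring. Qed.

Lemma Cconj_Cexpi t : Cconj (Cexpi t) = Cexpi (- t).
Proof. unfold Cexpi. now rewrite cos_neg, sin_neg. Qed.

Lemma Cconj_mul z w : Cconj (z * w)%X = (Cconj z * Cconj w)%X.
Proof. apply Cx_ext; simpl; ring. Qed.

Lemma inD_0 : inD 0%X.
Proof. unfold inD. rewrite Cmod_zero. lra. Qed.

Lemma inD_rot t z : inD z -> inD (Cexpi t * z)%X.
Proof. unfold inD. rewrite Cmod_mul, Cmod_Cexpi. lra. Qed.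

Lemma inD_sub_neq_0 z e : inD z -> Cmod e = 1 -> (1 - e * z)%X <> 0%X.
Proof.
  intros Hz He. apply Cmod_pos_neq.
  pose proof (Cmod_sub_ge 1%X (e * z)%X) as H.
  rewrite Cmod_mul, He, Cmod_one in H. unfold inD in Hz. lra.
Qed.

Lemma inD_add_neq_0 z e : inD z -> Cmod e = 1 -> (1 + e * z)%X <> 0%X.
Proof.
  intros Hz He. replace (1 + e * z)%X with (1 - (- e) * z)%X by ring.
  apply inD_sub_neq_0; [exact Hz | now rewrite Cmod_opp].
Qed.

(** * Complex derivatives *)

Lemma Rlt_Rmin x a b : x < Rmin a b -> x < a /\ x < b.
Proof. apply Rmin_Rgt_l. Qed.

Ltac split_Rmin :=
  repeat match goal with
  | H : _ < Rmin _ _ |- _ => apply Rlt_Rmin in H; destruct H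
  end.

(** Remainder form with a non-strict bound: the point [w = z] is allowed and no quotient occurs, so
    the product and chain rules need no case distinction. *)
Definition cder (F : Cx -> Cx) (z l : Cx) : Prop :=
  forall eps, 0 < eps -> exists del, 0 < del /\ forall w,
    Cmod (w - z)%X < del ->
    Cmod (F w - F z - l * (w - z))%X <= eps * Cmod (w - z)%X.

Lemma Cderiv_cder F z l : Cderiv F z l -> cder F z l.
Proof.
  intros H eps Heps. destruct (H eps Heps) as [d [Hd Hw]].
  exists d. split; [exact Hd|]. intros w Hwz.
  destruct (Rle_lt_dec (Cmod (w - z)%X) 0) as [H0|H0].
  - apply Cmod_le_0, Csub_eq_0 in H0. subst w.
    replace (F z - F z - l * (z - z))%X with 0%X by ring.
    rewrite Cmod_zero. apply Rmult_le_pos; [lra | apply Cmod_ge_0].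
  - specialize (Hw w (conj H0 Hwz)).
    replace (F w - F z - l * (w - z))%X
      with (((F w - F z) / (w - z) - l) * (w - z))%X
      by (field; now apply Cmod_pos_neq).
    rewrite Cmod_mul. apply Rmult_le_compat_r; lra.
Qed.

Lemma cder_unique F z l m : cder F z l -> cder F z m -> l = m.
Proof.
  intros Hl Hm. apply Csub_eq_0, Cmod_le_0.
  apply Rnot_lt_le. intros Hpos.
  set (e := Cmod (l - m)%X / 4).
  assert (He : 0 < e) by (unfold e; lra).
  destruct (Hl e He) as [d1 [Hd1 H1]], (Hm e He) as [d2 [Hd2 H2]].
  set (t := Rmin d1 d2 / 2).
  assert (Ht : 0 < t < d1 /\ t < d2).
  { unfold t. pose proof (Rmin_l d1 d2). pose proof (Rmin_r d1 d2).
    pose proof (Rmin_pos _ _ Hd1 Hd2). lra. }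
  assert (Ew : Cmod (z + RtoC t - z)%X = t).
  { replace (z + RtoC t - z)%X with (RtoC t) by ring.
    rewrite Cmod_RtoC. apply Rabs_pos_eq. lra. }
  specialize (H1 (z + RtoC t)%X). specialize (H2 (z + RtoC t)%X).
  rewrite Ew in H1, H2. specialize (H1 ltac:(lra)). specialize (H2 ltac:(lra)).
  assert (E : Cmod (l - m)%X * t =
    Cmod ((F (z + RtoC t) - F z - m * (z + RtoC t - z)) -
          (F (z + RtoC t) - F z - l * (z + RtoC t - z)))%X).
  { rewrite <- Ew at 1. rewrite <- Cmod_mul. f_equal. ring. }
  pose proof (Cmod_sub_le (F (z + RtoC t) - F z - m * (z + RtoC t - z))%X
          (F (z + RtoC t) - F z - l * (z + RtoC t - z))%X) as H3.
  unfold e in *. nra.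
Qed.

Lemma cder_ext_D F G z l :
  inD z -> (forall w, inD w -> F w = G w) -> cder F z l -> cder G z l.
Proof.
  intros Hz HFG H eps Heps. destruct (H eps Heps) as [d [Hd Hw]].
  unfold inD in Hz.
  exists (Rmin d (1 - Cmod z)). split; [apply Rmin_pos; lra|].
  intros w Hwz. rewrite <- !HFG.
  - apply Hw. eapply Rlt_le_trans; [exact Hwz | apply Rmin_l].
  - exact Hz.
  - unfold inD. pose proof (Cmod_sub_ge w z). pose proof (Rmin_r d (1 - Cmod z)).
    lra.
Qed.

Lemma cder_eq F z l m : cder F z l -> l = m -> cder F z m.
Proof. now intros H <-. Qed.

Lemma cder_lipschitz F z l :
  cder F z l -> exists d, 0 < d /\ forall w, Cmod (w - z)%X < d ->
    Cmod (F w - F z)%X <= (Cmod l + 1) * Cmod (w - z)%X.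
Proof.
  intros H. destruct (H 1 Rlt_0_1) as [d [Hd Hw]].
  exists d. split; [exact Hd|]. intros w Hwz. specialize (Hw w Hwz).
  replace (F w - F z)%X with ((F w - F z - l * (w - z)) + l * (w - z))%X by ring.
  eapply Rle_trans; [apply Cmod_add_le|]. rewrite (Cmod_mul l). lra.
Qed.

Lemma cder_continuous F z l :
  cder F z l -> forall eps, 0 < eps -> exists d, 0 < d /\ forall w,
    Cmod (w - z)%X < d -> Cmod (F w - F z)%X < eps.
Proof.
  intros H eps Heps. destruct (cder_lipschitz _ _ _ H) as [d [Hd Hw]].
  pose proof (Cmod_ge_0 l) as Hl.
  exists (Rmin d (eps / (Cmod l + 2))).
  assert (Hq : 0 < eps / (Cmod l + 2)) by (apply Rdiv_lt_0_compat; lra).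
  split; [apply Rmin_pos; lra|]. intros w Hwz.
  pose proof (Rmin_l d (eps / (Cmod l + 2))).
  pose proof (Rmin_r d (eps / (Cmod l + 2))).
  specialize (Hw w ltac:(lra)).
  assert (E : (Cmod l + 2) * (eps / (Cmod l + 2)) = eps) by (field; lra).
  pose proof (Cmod_ge_0 (w - z)%X). nra.
Qed.

Lemma cder_const c z : cder (fun _ => c) z 0%X.
Proof.
  intros eps Heps. exists 1. split; [lra|]. intros w _.
  replace (c - c - 0 * (w - z))%X with 0%X by ring.
  rewrite Cmod_zero. apply Rmult_le_pos; [lra | apply Cmod_ge_0].
Qed.

Lemma cder_id z : cder (fun w => w) z 1%X.
Proof.
  intros eps Heps. exists 1. split; [lra|]. intros w _.
  replace (w - z - 1 * (w - z))%X with 0%X by ring.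
  rewrite Cmod_zero. apply Rmult_le_pos; [lra | apply Cmod_ge_0].
Qed.

Lemma cder_add F G z l m :
  cder F z l -> cder G z m -> cder (fun w => F w + G w)%X z (l + m)%X.
Proof.
  intros HF HG eps Heps.
  destruct (HF (eps / 2) ltac:(lra)) as [d1 [Hd1 H1]].
  destruct (HG (eps / 2) ltac:(lra)) as [d2 [Hd2 H2]].
  exists (Rmin d1 d2). split; [now apply Rmin_pos|]. intros w Hw.
  specialize (H1 w (Rlt_le_trans _ _ _ Hw (Rmin_l _ _))).
  specialize (H2 w (Rlt_le_trans _ _ _ Hw (Rmin_r _ _))).
  replace (F w + G w - (F z + G z) - (l + m) * (w - z))%X
    with ((F w - F z - l * (w - z)) + (G w - G z - m * (w - z)))%X by ring.
  eapply Rle_trans; [apply Cmod_add_le|]. lra.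
Qed.

Lemma cder_mul F G z l m :
  cder F z l -> cder G z m ->
  cder (fun w => F w * G w)%X z (l * G z + F z * m)%X.
Proof.
  intros HF HG eps Heps.
  (* [M] collects the coefficients of the three error terms; the quadratic one becomes linear
     because the radius is also at most [e]. *)
  set (M := Cmod (F z) + Cmod (G z) + (Cmod l + 1) * (Cmod m + 1)).
  pose proof (Cmod_ge_0 (F z)) as p1. pose proof (Cmod_ge_0 (G z)) as p2.
  pose proof (Cmod_ge_0 l) as p3. pose proof (Cmod_ge_0 m) as p4.
  assert (HM : 1 <= M) by (unfold M; nra).
  set (e := eps / M).
  assert (He : 0 < e) by (apply Rdiv_lt_0_compat; lra).
  assert (HeM : e * M = eps) by (unfold e; field; lra).
  destruct (HF e He) as [d1 [Hd1 H1]].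
  destruct (HG e He) as [d2 [Hd2 H2]].
  destruct (cder_lipschitz _ _ _ HF) as [d3 [Hd3 H3]].
  destruct (cder_lipschitz _ _ _ HG) as [d4 [Hd4 H4]].
  exists (Rmin (Rmin d1 d2) (Rmin (Rmin d3 d4) e)).
  split; [repeat apply Rmin_pos; assumption|]. intros w Hw.
  split_Rmin.
  specialize (H1 w ltac:(lra)). specialize (H2 w ltac:(lra)).
  specialize (H3 w ltac:(lra)). specialize (H4 w ltac:(lra)).
  replace (F w * G w - F z * G z - (l * G z + F z * m) * (w - z))%X
    with ((F w - F z - l * (w - z)) * G z + F z * (G w - G z - m * (w - z)) +
          (F w - F z) * (G w - G z))%X by ring.
  set (D := Cmod (w - z)%X) in *. assert (HD : 0 <= D) by apply Cmod_ge_0.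
  eapply Rle_trans; [apply Cmod_add_le|].
  eapply Rle_trans; [apply Rplus_le_compat_r, Cmod_add_le|].
  rewrite !Cmod_mul.
  assert (Cmod (F w - F z - l * (w - z))%X * Cmod (G z) <= e * D * Cmod (G z))
    by (apply Rmult_le_compat_r; assumption).
  assert (Cmod (F z) * Cmod (G w - G z - m * (w - z))%X <= Cmod (F z) * (e * D))
    by (apply Rmult_le_compat_l; assumption).
  assert (Cmod (F w - F z)%X * Cmod (G w - G z)%X <=
          ((Cmod l + 1) * D) * ((Cmod m + 1) * D))
    by (apply Rmult_le_compat; auto using Cmod_ge_0).
  assert (((Cmod l + 1) * D) * ((Cmod m + 1) * D) <=
          ((Cmod l + 1) * (Cmod m + 1)) * (e * D)).
  { replace (((Cmod l + 1) * D) * ((Cmod m + 1) * D))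
      with (((Cmod l + 1) * (Cmod m + 1)) * (D * D)) by ring.
    apply Rmult_le_compat_l; [nra|]. apply Rmult_le_compat_r; lra. }
  rewrite <- HeM. unfold M. lra.
Qed.

Lemma cder_scal c F z l : cder F z l -> cder (fun w => c * F w)%X z (c * l)%X.
Proof.
  intros H. eapply cder_eq; [apply (cder_mul (fun _ => c)); [apply cder_const | exact H]|].
  ring.
Qed.

Lemma cder_sub F G z l m :
  cder F z l -> cder G z m -> cder (fun w => F w - G w)%X z (l - m)%X.
Proof.
  intros HF HG.
  pose proof (cder_add _ _ _ _ _ HF (cder_scal (- (1))%X _ _ _ HG)) as H.
  replace (l - m)%X with (l + - (1) * m)%X by ring.
  intros eps Heps. destruct (H eps Heps) as [d [Hd Hw]].
  exists d. split; [exact Hd|]. intros w Hwz. specialize (Hw w Hwz).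
  replace (F w - G w - (F z - G z) - (l + - (1) * m) * (w - z))%X with
   (F w + - (1) * G w - (F z + - (1) * G z) - (l + - (1) * m) * (w - z))%X by ring.
  exact Hw.
Qed.

Lemma cder_comp F G z l m :
  cder F z l -> cder G (F z) m -> cder (fun w => G (F w)) z (m * l)%X.
Proof.
  intros HF HG eps Heps.
  pose proof (Cmod_ge_0 l) as Hl. pose proof (Cmod_ge_0 m) as Hm.
  set (M := Cmod l + 1 + Cmod m).
  set (e := eps / M).
  assert (He : 0 < e) by (apply Rdiv_lt_0_compat; unfold M; lra).
  assert (HeM : e * M = eps) by (unfold e; field; unfold M; lra).
  destruct (HF e He) as [d1 [Hd1 H1]].
  destruct (HG e He) as [d2 [Hd2 H2]].
  destruct (cder_lipschitz _ _ _ HF) as [d3 [Hd3 H3]].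
  destruct (cder_continuous _ _ _ HF d2 Hd2) as [d4 [Hd4 H4]].
  exists (Rmin (Rmin d1 d3) d4).
  split; [repeat apply Rmin_pos; assumption|]. intros w Hw.
  split_Rmin.
  specialize (H1 w ltac:(lra)). specialize (H3 w ltac:(lra)).
  specialize (H2 (F w) (H4 w ltac:(lra))).
  replace (G (F w) - G (F z) - m * l * (w - z))%X
    with ((G (F w) - G (F z) - m * (F w - F z)) +
          m * (F w - F z - l * (w - z)))%X by ring.
  eapply Rle_trans; [apply Cmod_add_le|]. rewrite (Cmod_mul m).
  set (D := Cmod (w - z)%X) in *.
  assert (e * Cmod (F w - F z)%X <= e * ((Cmod l + 1) * D))
    by (apply Rmult_le_compat_l; lra).
  assert (Cmod m * Cmod (F w - F z - l * (w - z))%X <= Cmod m * (e * D))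
    by (apply Rmult_le_compat_l; lra).
  rewrite <- HeM. unfold M. lra.
Qed.

Lemma cder_Cinv z : z <> 0%X -> cder Cinv z (- Cinv (z * z))%X.
Proof.
  intros Hz eps Heps. pose proof (Cmod_pos z Hz) as Hm.
  set (r := Cmod z) in *.
  (* The first radius keeps [Cmod w > r / 2]; with it the second bounds the exact remainder
     [(w - z)^2 / (w z^2)]. *)
  exists (Rmin (r / 2) (eps * (r * r * r) / 2)).
  assert (0 < r * r * r) by (repeat apply Rmult_lt_0_compat; assumption).
  assert (0 < eps * (r * r * r)) by (apply Rmult_lt_0_compat; assumption).
  split; [apply Rmin_pos; lra|]. intros w Hw.
  pose proof (Rmin_l (r / 2) (eps * (r * r * r) / 2)).
  pose proof (Rmin_r (r / 2) (eps * (r * r * r) / 2)).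
  assert (Hwm : r / 2 < Cmod w).
  { pose proof (Cmod_sub_ge z w) as Hzw. rewrite Cmod_sub_sym in Hzw.
    unfold r in *. lra. }
  assert (Hw0 : w <> 0%X) by (apply Cmod_pos_neq; lra).
  replace (Cinv w - Cinv z - - Cinv (z * z) * (w - z))%X
    with ((w - z) * (w - z) * Cinv (w * (z * z)))%X by (field; auto).
  assert (Hwzz : (w * (z * z))%X <> 0%X).
  { apply Cmod_pos_neq. rewrite !Cmod_mul. fold r.
    repeat apply Rmult_lt_0_compat; lra. }
  rewrite Cmod_mul, Cmod_Cinv, !Cmod_mul by assumption. fold r.
  set (D := Cmod (w - z)%X) in *. assert (HD : 0 <= D) by apply Cmod_ge_0.
  assert (Hrr : 0 < r * r) by nra.
  assert (Hwr : 0 < Cmod w * (r * r)) by nra.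
  apply Rmult_le_reg_r with (Cmod w * (r * r)); [exact Hwr|].
  rewrite Rmult_assoc, Rinv_l, Rmult_1_r by lra.
  replace (eps * D * (Cmod w * (r * r))) with (D * (eps * (r * r) * Cmod w)) by ring.
  apply Rmult_le_compat_l; [exact HD|].
  assert (eps * (r * r) * (r / 2) <= eps * (r * r) * Cmod w)
    by (apply Rmult_le_compat_l; nra).
  nra.
Qed.

Lemma cder_div F G z l m :
  cder F z l -> cder G z m -> G z <> 0%X ->
  cder (fun w => F w / G w)%X z ((l * G z - F z * m) / (G z * G z))%X.
Proof.
  intros HF HG Hz. eapply cder_eq.
  - apply (cder_mul F (fun w => Cinv (G w))); [exact HF|].
    apply (cder_comp G Cinv); [exact HG | now apply cder_Cinv].
  - simpl. field. exact Hz.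
Qed.

Lemma cder_pow z n : cder (fun w => w ^ S n)%X z (RtoC (INR (S n)) * z ^ n)%X.
Proof.
  induction n as [|n IH].
  - eapply cder_eq; [apply (cder_mul (fun w => w) (fun _ => 1%X));
      [apply cder_id | apply cder_const]|].
    simpl. ring.
  - eapply cder_eq; [apply (cder_mul (fun w => w) (fun w => w ^ S n)%X);
      [apply cder_id | exact IH]|].
    rewrite (S_INR (S n)), RtoC_add. simpl Cpow. change (RtoC 1) with 1%X. ring.
Qed.

(** * The shear principle *)

(** Nearby points are compared with [x] only, not with each other: this is what a first-order
    expansion at [x] delivers. *)
Definition increasing_at (f : R -> R) (p q x : R) : Prop :=
  exists d, 0 < d /\ forall t, p <= t <= q -> Rabs (t - x) < d -> t <> x ->
    0 < (t - x) * (f t - f x).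

(** Supremum argument on the set of [x] such that [f] stays above [f p] on [[p, x]]. Increase at the
    supremum [s] from the left puts [s] in the set; increase to the right would push the set past
    [s] if [s < q]. *)
Lemma locally_increasing_le f p q :
  p <= q -> (forall x, p <= x <= q -> increasing_at f p q x) -> f p <= f q.
Proof.
  intros Hpq Hloc.
  set (E := fun x => p <= x <= q /\ forall t, p <= t <= x -> f p <= f t).
  assert (HEp : E p).
  { split; [lra|]. intros t Ht. replace t with p by lra. lra. }
  destruct (completeness E) as [s [Hub Hlub]].
  - exists q. intros x [Hx _]. lra.
  - now exists p.
  - assert (Hs : p <= s <= q).
    { split; [now apply Hub|]. apply Hlub. intros x [Hx _]. lra. }
    assert (Hbelow : forall t, p <= t < s -> f p <= f t).
    { intros t Ht. apply Rnot_lt_le. intros Hlt.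
      assert (s <= t); [|lra]. apply Hlub. intros x [Hx Hxt].
      apply Rnot_lt_le. intros Htx. specialize (Hxt t ltac:(lra)). lra. }
    destruct (Hloc s Hs) as [d [Hd Hinc]].
    assert (Hfs : f p <= f s).
    { destruct (Rle_lt_or_eq_dec p s (proj1 Hs)) as [Hlt|<-]; [|lra].
      set (t := Rmax p (s - d / 2)).
      assert (Ht : p <= t < s /\ s - d / 2 <= t).
      { unfold t. pose proof (Rmax_l p (s - d / 2)). pose proof (Rmax_r p (s - d / 2)).
        pose proof (Rmax_lub_lt p (s - d / 2) s ltac:(lra) ltac:(lra)). lra. }
      specialize (Hbelow t ltac:(lra)).
      specialize (Hinc t ltac:(lra)).
      rewrite Rabs_left in Hinc by lra. specialize (Hinc ltac:(lra) ltac:(lra)). nra. }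
    destruct (Rle_lt_or_eq_dec s q (proj2 Hs)) as [Hlt|<-]; [|exact Hfs].
    exfalso. set (t := Rmin q (s + d / 2)).
    assert (Ht : s < t <= q /\ t <= s + d / 2).
    { unfold t. pose proof (Rmin_l q (s + d / 2)). pose proof (Rmin_r q (s + d / 2)).
      pose proof (Rmin_glb_lt q (s + d / 2) s ltac:(lra) ltac:(lra)). lra. }
    assert (E t); [|specialize (Hub t H); lra].
    split; [lra|]. intros u Hu.
    destruct (Rle_lt_dec s u) as [Hsu|Hus]; [|now apply Hbelow; lra].
    destruct (Req_dec u s) as [->|Hne]; [exact Hfs|].
    specialize (Hinc u ltac:(lra)).
    rewrite Rabs_pos_eq in Hinc by lra. specialize (Hinc ltac:(lra) Hne). nra.
Qed.

(** Strictness comes from one step to the right of [p]; after it the weak inequality is enough. *)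
Lemma locally_increasing_lt f p q :
  p < q -> (forall x, p <= x <= q -> increasing_at f p q x) -> f p < f q.
Proof.
  intros Hpq Hloc. destruct (Hloc p ltac:(lra)) as [d [Hd Hinc]].
  set (t := Rmin q (p + d / 2)).
  assert (Ht : p < t <= q /\ t <= p + d / 2).
  { unfold t. pose proof (Rmin_l q (p + d / 2)). pose proof (Rmin_r q (p + d / 2)).
    pose proof (Rmin_glb_lt q (p + d / 2) p ltac:(lra) ltac:(lra)). lra. }
  specialize (Hinc t ltac:(lra)).
  rewrite Rabs_pos_eq in Hinc by lra. specialize (Hinc ltac:(lra) ltac:(lra)).
  assert (f t <= f q); [|nra].
  apply locally_increasing_le; [lra|]. intros x Hx.
  destruct (Hloc x ltac:(lra)) as [d' [Hd' H']].
  exists d'. split; [exact Hd'|]. intros u Hu. apply H'. lra.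
Qed.

(** Along a level curve of [Im Psi] the increment [Re Phi] has the sign of the
    abscissa's increment, to first order by the factor
    [Re (m * conj psi) / Re psi]. *)
Lemma level_curve_increasing Phi Psi w m psi :
  cder Phi w m -> cder Psi w psi ->
  0 < fst psi -> 0 < fst m * fst psi + snd m * snd psi ->
  exists d, 0 < d /\ forall w', Cmod (w' - w)%X < d ->
    snd (Psi w') = snd (Psi w) -> fst w' <> fst w ->
    0 < (fst w' - fst w) * (fst (Phi w') - fst (Phi w)).
Proof.
  destruct m as [mu nu], psi as [rho sg]; simpl. intros HPhi HPsi Hrho HJ.
  set (J := mu * rho + nu * sg) in *.
  (* Along the level curve [q] is close to [- (sg / rho) p], so [Rabs p + Rabs q <= K * Rabs p]:
     errors measured by the displacement are controlled by the abscissa alone. *)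
  set (K := (2 * rho + 2 * Rabs sg) / rho).
  pose proof (Rabs_pos sg) as Hsg. pose proof (Rabs_pos nu) as Hnu.
  assert (HK : 0 < K) by (apply Rdiv_lt_0_compat; lra).
  assert (HKr : rho * K = 2 * rho + 2 * Rabs sg) by (unfold K; field; lra).
  assert (HL : 0 < (Rabs nu + rho) * K) by nra.
  (* The first bound lets half of [rho * S] absorb the error in the estimate of [S]; the second
     keeps the total error below half of [J * Rabs p]. *)
  set (e := Rmin (rho / 2) (J / (2 * ((Rabs nu + rho) * K)))).
  assert (He : 0 < e).
  { apply Rmin_pos; [lra|]. apply Rdiv_lt_0_compat; lra. }
  assert (He1 : e <= rho / 2) by apply Rmin_l.
  assert (He2 : e * ((Rabs nu + rho) * K) <= J / 2).
  { replace (J / 2) with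
      (J / (2 * ((Rabs nu + rho) * K)) * ((Rabs nu + rho) * K)) by (field; nra).
    apply Rmult_le_compat_r; [lra | apply Rmin_r]. }
  destruct (HPhi e He) as [d1 [Hd1 H1]], (HPsi e He) as [d2 [Hd2 H2]].
  exists (Rmin d1 d2). split; [now apply Rmin_pos|]. intros w' Hw Hlev Hne.
  split_Rmin.
  specialize (H1 w' ltac:(lra)). specialize (H2 w' ltac:(lra)).
  set (p := fst w' - fst w) in *. set (q := snd w' - snd w).
  assert (Hp : p <> 0) by (unfold p; lra).
  pose proof (Cmod_le_abs (w' - w)%X) as HD. simpl in HD.
  fold (Rminus (fst w') (fst w)) in HD. fold (Rminus (snd w') (snd w)) in HD.
  fold p q in HD.
  pose proof (Cmod_fst (Phi w' - Phi w - (mu, nu) * (w' - w))%X) as HF. simpl in HF.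
  pose proof (Cmod_snd (Psi w' - Psi w - (rho, sg) * (w' - w))%X) as HS. simpl in HS.
  rewrite Hlev in HS.
  set (X := fst (Phi w') - fst (Phi w)) in *.
  replace (fst (Phi w') + - fst (Phi w) + - (mu * (fst w' + - fst w) - nu * (snd w' + - snd w)))
    with (X - (mu * p - nu * q)) in HF by (unfold X, p, q; ring).
  replace (snd (Psi w) + - snd (Psi w) + - (rho * (snd w' + - snd w) + sg * (fst w' + - fst w)))
    with (- (rho * q + sg * p)) in HS by (unfold p, q; ring).
  rewrite Rabs_Ropp in HS.
  set (S := Rabs p + Rabs q) in *.
  set (s := rho * q + sg * p) in *.
  assert (Hs : Rabs s <= e * S) by nra.
  assert (HX : Rabs (X - (mu * p - nu * q)) <= e * S) by nra.
  assert (HS2 : S <= K * Rabs p).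
  { assert (Hq : rho * Rabs q <= Rabs s + Rabs sg * Rabs p).
    { rewrite <- (Rabs_pos_eq rho) at 1 by lra. rewrite <- !Rabs_mult.
      replace (rho * q) with (s - sg * p) by (unfold s; ring).
      eapply Rle_trans; [apply Rabs_triang|]. rewrite Rabs_Ropp. lra. }
    assert (e * S <= rho / 2 * S).
    { apply Rmult_le_compat_r; [|exact He1]. unfold S.
      pose proof (Rabs_pos p); pose proof (Rabs_pos q); lra. }
    apply Rmult_le_reg_l with rho; [exact Hrho|].
    rewrite <- Rmult_assoc, HKr. unfold S in *. lra. }
  (* Eliminating [q] between [X ~ mu p - nu q] and [rho q + sg p ~ 0] gives [rho X ~ J p]. *)
  assert (Habs : Rabs (rho * X - J * p) <= (Rabs nu + rho) * (e * S)).
  { replace (rho * X - J * p)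
      with (- (nu * s) + rho * (X - (mu * p - nu * q))) by (unfold J, s; ring).
    eapply Rle_trans; [apply Rabs_triang|].
    rewrite Rabs_Ropp, !Rabs_mult, (Rabs_pos_eq rho) by lra.
    pose proof (Rmult_le_compat_l _ _ _ Hnu Hs).
    pose proof (Rmult_le_compat_l rho _ _ (Rlt_le _ _ Hrho) HX). lra. }
  assert (Hb : (Rabs nu + rho) * (e * S) <= J / 2 * Rabs p).
  { apply Rle_trans with ((Rabs nu + rho) * (e * (K * Rabs p))).
    - apply Rmult_le_compat_l; [lra|]. apply Rmult_le_compat_l; lra.
    - replace ((Rabs nu + rho) * (e * (K * Rabs p)))
        with (e * ((Rabs nu + rho) * K) * Rabs p) by ring.
      apply Rmult_le_compat_r; [apply Rabs_pos | exact He2]. }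
  apply Rmult_lt_reg_l with rho; [exact Hrho|]. rewrite Rmult_0_r.
  destruct (Rle_lt_dec 0 p) as [Hp0|Hp0].
  - rewrite (Rabs_pos_eq p) in Hb by exact Hp0.
    apply Rabs_le_between in Habs. assert (Hp1 : 0 < p) by lra.
    assert (0 < J * p) by now apply Rmult_lt_0_compat.
    replace (rho * (p * X)) with (p * (rho * X)) by ring.
    apply Rmult_lt_0_compat; lra.
  - rewrite (Rabs_left p) in Hb by exact Hp0.
    apply Rabs_le_between in Habs.
    assert (0 < J * - p) by (apply Rmult_lt_0_compat; lra).
    replace (rho * (p * X)) with (- p * - (rho * X)) by ring.
    apply Rmult_lt_0_compat; lra.
Qed.

(** A vertical step [h] is the complex increment [Ci * h], and [Im (Ci * psi) = Re psi]. *)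
Lemma vertical_derivative Psi x y psi :
  cder Psi (x, y) psi ->
  derivable_pt_lim (fun t => snd (Psi (x, t))) y (fst psi).
Proof.
  intros H eps Heps. destruct (H (eps / 2) ltac:(lra)) as [d [Hd Hw]].
  exists (mkposreal d Hd). simpl. intros h Hh Hhd.
  assert (E : ((x, (y + h)%R) - (x, y))%X = (Ci * RtoC h)%X)
    by (apply Cx_ext; simpl; ring).
  assert (Em : Cmod (Ci * RtoC h)%X = Rabs h).
  { rewrite Cmod_mul, Cmod_RtoC. change (Cmod Ci) with (Complex.Cmod Complex.Ci).
    rewrite Cmod_Ci. ring. }
  specialize (Hw (x, (y + h)%R)). rewrite E, Em in Hw. specialize (Hw Hhd).
  pose proof (Cmod_snd (Psi (x, (y + h)%R) - Psi (x, y) - psi * (Ci * RtoC h))%X) as HS.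
  simpl in HS.
  set (D := snd (Psi (x, (y + h)%R)) - snd (Psi (x, y))) in *.
  match type of HS with Rabs ?e <= _ =>
    replace e with (D - fst psi * h) in HS by (unfold D; ring) end.
  pose proof (Rabs_pos_lt h Hh) as Hp.
  replace (D / h - fst psi) with ((D - fst psi * h) / h) by (field; exact Hh).
  unfold Rdiv. rewrite Rabs_mult, Rabs_inv.
  apply Rmult_lt_reg_r with (Rabs h); [exact Hp|].
  rewrite Rmult_assoc, Rinv_l, Rmult_1_r by lra.
  nra.
Qed.

(** Openness and order convexity cover half-lines and bounded intervals alike, without naming
    endpoints. *)
Definition open_interval (I : R -> Prop) : Prop :=
  (forall x, I x -> exists d, 0 < d /\ forall t, Rabs (t - x) < d -> I t) /\
  (forall x y t, I x -> I y -> x <= t <= y -> I t).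

Section LevelCurves.

Variables (I : R -> Prop) (Psi dPsi : Cx -> Cx) (k : R -> R).
Hypothesis HI : open_interval I.
Hypothesis HPsi : forall w, I (fst w) -> cder Psi w (dPsi w).
Hypothesis Hk : forall x, I x -> 0 < k x.
Hypothesis HdPsi : forall w, I (fst w) -> k (fst w) <= fst (dPsi w).

Lemma vertical_growth x y1 y2 :
  I x -> y1 < y2 -> k x * (y2 - y1) <= snd (Psi (x, y2)) - snd (Psi (x, y1)).
Proof.
  intros Hx Hy.
  destruct (MVT_cor2 (fun t => snd (Psi (x, t))) (fun t => fst (dPsi (x, t))) y1 y2 Hy)
    as [t [Ht _]].
  - intros t _. apply vertical_derivative. now apply HPsi.
  - rewrite Ht. apply Rmult_le_compat_r; [lra|]. now apply (HdPsi (x, t)).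
Qed.

Lemma level_point x c : I x -> exists y, snd (Psi (x, y)) = c.
Proof.
  intros Hx. pose proof (Hk x Hx) as Hkx.
  set (v := snd (Psi (x, 0)) - c).
  (* Over a height [Y] the growth is at least [Rabs v + 1], more than the gap [v] at height 0, so
     the sign changes on [[-Y, Y]]. *)
  set (Y := (Rabs v + 1) / k x).
  assert (HY : 0 < Y).
  { apply Rdiv_lt_0_compat; [pose proof (Rabs_pos v); lra | exact Hkx]. }
  assert (HkY : k x * Y = Rabs v + 1) by (unfold Y; field; lra).
  pose proof (vertical_growth x 0 Y Hx HY) as H1.
  pose proof (vertical_growth x (- Y) 0 Hx ltac:(lra)) as H2.
  rewrite Rminus_0_r, HkY in H1.
  replace (0 - - Y) with Y in H2 by ring. rewrite HkY in H2.
  pose proof (Rle_abs v). pose proof (Rle_abs (- v)) as Hv. rewrite Rabs_Ropp in Hv.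
  destruct (Ranalysis5.IVT_interv (fun t => snd (Psi (x, t)) - c) (- Y) Y)
    as [y [_ Hy]].
  - intros t _. apply derivable_continuous_pt. exists (fst (dPsi (x, t)) - 0).
    apply (derivable_pt_lim_minus (fun t => snd (Psi (x, t))) (fun _ => c)).
    + apply vertical_derivative. now apply HPsi.
    + apply derivable_pt_lim_const.
  - lra.
  - unfold v in *. lra.
  - unfold v in *. lra.
  - exists y. lra.
Qed.

(** Ordinate over [x] of the curve [Im Psi = c]; the choice is meaningful only for [x] in [I]. *)
Definition level_height (c x : R) : R :=
  epsilon (inhabits 0) (fun y => snd (Psi (x, y)) = c).

Lemma level_height_spec c x : I x -> snd (Psi (x, level_height c x)) = c.
Proof. intros Hx. unfold level_height. apply epsilon_spec. now apply level_point. Qed.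

Lemma level_height_unique c x y : I x -> snd (Psi (x, y)) = c -> y = level_height c x.
Proof.
  intros Hx Hy. pose proof (level_height_spec c x Hx) as Hs.
  pose proof (Hk x Hx).
  destruct (Rtotal_order y (level_height c x)) as [Hlt|[Heq|Hgt]]; [|exact Heq|].
  - pose proof (vertical_growth x _ _ Hx Hlt). nra.
  - pose proof (vertical_growth x _ _ Hx Hgt). nra.
Qed.

(** A direct substitute for the implicit function theorem. Over [x], the heights [y + eps / 2] and
    [y - eps / 2] lie above and below the level by at least [k x * (eps / 2)]; continuity of [Psi]
    keeps them on their sides over nearby [t], and vertical monotonicity traps the level between
    them. *)
Lemma level_height_continuous c x eps :
  I x -> 0 < eps -> exists d, 0 < d /\ forall t, Rabs (t - x) < d ->
    I t /\ Rabs (level_height c t - level_height c x) < eps.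
Proof.
  intros Hx Heps. pose proof (Hk x Hx) as Hkx.
  set (y := level_height c x).
  pose proof (level_height_spec c x Hx) as Hy. fold y in Hy.
  pose proof (vertical_growth x y (y + eps / 2) Hx ltac:(lra)) as Hup.
  pose proof (vertical_growth x (y - eps / 2) y Hx ltac:(lra)) as Hdn.
  replace (y + eps / 2 - y) with (eps / 2) in Hup by ring.
  replace (y - (y - eps / 2)) with (eps / 2) in Hdn by ring.
  assert (He : 0 < k x * (eps / 2)) by nra.
  destruct (proj1 HI x Hx) as [d0 [Hd0 H0]].
  destruct (cder_continuous _ _ _ (HPsi (x, (y + eps / 2)%R) Hx) _ He) as [d1 [Hd1 H1]].
  destruct (cder_continuous _ _ _ (HPsi (x, (y - eps / 2)%R) Hx) _ He) as [d2 [Hd2 H2]].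
  exists (Rmin d0 (Rmin d1 d2)). split; [repeat apply Rmin_pos; assumption|].
  intros t Ht. split_Rmin. assert (HIt : I t) by auto. split; [exact HIt|].
  assert (Ed : forall z, Cmod ((t, z) - (x, z))%X = Rabs (t - x)).
  { intros z. replace ((t, z) - (x, z))%X with (RtoC (t - x)) by (apply Cx_ext; simpl; ring).
    apply Cmod_RtoC. }
  specialize (H1 (t, (y + eps / 2)%R)). rewrite Ed in H1. specialize (H1 ltac:(lra)).
  specialize (H2 (t, (y - eps / 2)%R)). rewrite Ed in H2. specialize (H2 ltac:(lra)).
  pose proof (Rle_lt_trans _ _ _ (Cmod_snd _) H1) as G1.
  pose proof (Rle_lt_trans _ _ _ (Cmod_snd _) H2) as G2.
  simpl in G1, G2. apply Rabs_def2 in G1. apply Rabs_def2 in G2.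
  pose proof (level_height_spec c t HIt) as Hyt.
  pose proof (Hk t HIt) as Hkt.
  set (yt := level_height c t) in *.
  apply Rabs_def1.
  - apply Rnot_le_lt. intros Hle.
    pose proof (vertical_growth t (y + eps / 2) yt HIt ltac:(lra)). nra.
  - apply Rnot_le_lt. intros Hle.
    pose proof (vertical_growth t yt (y - eps / 2) HIt ltac:(lra)). nra.
Qed.

Lemma level_curve_continuous c x eps :
  I x -> 0 < eps -> exists d, 0 < d /\ forall t, Rabs (t - x) < d ->
    Cmod ((t, level_height c t) - (x, level_height c x))%X < eps.
Proof.
  intros Hx Heps.
  destruct (level_height_continuous c x (eps / 2) Hx ltac:(lra)) as [d [Hd H]].
  exists (Rmin d (eps / 2)). split; [apply Rmin_pos; lra|]. intros t Ht.
  split_Rmin. destruct (H t ltac:(assumption)) as [_ Hy].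
  eapply Rle_lt_trans; [apply Cmod_le_abs|]. simpl.
  unfold Rminus in *. lra.
Qed.

Variables (Phi dPhi : Cx -> Cx).
Hypothesis HPhi : forall w, I (fst w) -> cder Phi w (dPhi w).
Hypothesis HJ : forall w, I (fst w) ->
  0 < fst (dPhi w) * fst (dPsi w) + snd (dPhi w) * snd (dPsi w).

Lemma level_curve_strictly_increasing c p q :
  I p -> I q -> p < q ->
  fst (Phi (p, level_height c p)) < fst (Phi (q, level_height c q)).
Proof.
  intros Hp Hq Hpq.
  apply (locally_increasing_lt (fun x => fst (Phi (x, level_height c x)))); [exact Hpq|].
  intros x Hx. assert (HIx : I x) by (apply (proj2 HI p q); assumption).
  pose proof (Hk x HIx). pose proof (HdPsi (x, level_height c x) HIx) as Hd'.
  simpl in Hd'.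
  destruct (level_curve_increasing Phi Psi (x, level_height c x) _ _
              (HPhi (x, level_height c x) HIx) (HPsi (x, level_height c x) HIx)) as [e [He Hinc]].
  - lra.
  - now apply HJ.
  - destruct (level_curve_continuous c x e HIx He) as [d [Hd Hcont]].
    exists d. split; [exact Hd|]. intros t Ht Htd Hne.
    assert (HIt : I t) by (apply (proj2 HI p q); assumption).
    apply (Hinc (t, level_height c t)); simpl.
    + now apply Hcont.
    + now rewrite !level_height_spec.
    + exact Hne.
Qed.

Lemma level_curve_ivt c p q u :
  I p -> I q -> p < q ->
  fst (Phi (p, level_height c p)) < u < fst (Phi (q, level_height c q)) ->
  exists x, I x /\ fst (Phi (x, level_height c x)) = u.
Proof.
  intros Hp Hq Hpq Hu.
  destruct (Ranalysis5.IVT_interv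
    (fun x => fst (Phi (x, level_height c x)) - u) p q) as [x [Hx Hxu]].
  - intros x Hx. assert (HIx : I x) by (apply (proj2 HI p q); assumption).
    intros eps Heps.
    destruct (cder_continuous _ _ _ (HPhi (x, level_height c x) HIx) eps Heps)
      as [e [He Hcont]].
    destruct (level_curve_continuous c x e HIx He) as [d [Hd Hlev]].
    exists d. split; [exact Hd|]. intros t [_ Ht]. simpl in *.
    unfold Rdist in *. specialize (Hcont _ (Hlev t Ht)).
    eapply Rle_lt_trans; [|exact Hcont].
    eapply Rle_trans; [|apply Cmod_fst]. right. f_equal. simpl. ring.
  - exact Hpq.
  - lra.
  - lra.
  - exists x. split; [apply (proj2 HI p q); assumption | lra].
Qed.

End LevelCurves.

(** [H + conj G] has real part [Re (H + G)] and imaginary part [Im (H - G)], and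
    [|dG| < |dH|] means [Re ((dH + dG) * conj (dH - dG)) > 0]: the map is
    monotone along the level curves of [Im (H - G)], which are graphs over [I]. *)
Lemma shear_principle (I : R -> Prop) (k : R -> R) (H G dH dG : Cx -> Cx) :
  open_interval I ->
  (forall w, I (fst w) -> cder H w (dH w)) ->
  (forall w, I (fst w) -> cder G w (dG w)) ->
  (forall x, I x -> 0 < k x) ->
  (forall w, I (fst w) -> k (fst w) <= fst (dH w - dG w)%X) ->
  (forall w, I (fst w) -> Cmod (dG w) < Cmod (dH w)) ->
  (forall w1 w2, I (fst w1) -> I (fst w2) ->
     (H w1 + Cconj (G w1))%X = (H w2 + Cconj (G w2))%X -> w1 = w2) /\
  (forall w1 w2 u, I (fst w1) -> I (fst w2) ->
     snd (H w1 + Cconj (G w1))%X = snd (H w2 + Cconj (G w2))%X ->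
     fst (H w1 + Cconj (G w1))%X <= u <= fst (H w2 + Cconj (G w2))%X ->
     exists w, I (fst w) /\
       (H w + Cconj (G w))%X = (u, snd (H w1 + Cconj (G w1))%X)).
Proof.
  intros HI HH HG Hk Hge Hlt.
  set (Phi := fun w => (H w + G w)%X). set (dPhi := fun w => (dH w + dG w)%X).
  set (Psi := fun w => (H w - G w)%X). set (dPsi := fun w => (dH w - dG w)%X).
  assert (HPhi : forall w, I (fst w) -> cder Phi w (dPhi w))
    by (intros; apply cder_add; auto).
  assert (HPsi : forall w, I (fst w) -> cder Psi w (dPsi w))
    by (intros; apply cder_sub; auto).
  assert (HJ : forall w, I (fst w) ->
    0 < fst (dPhi w) * fst (dPsi w) + snd (dPhi w) * snd (dPsi w)).
  { intros w Hw. pose proof (Cmod_lt_sq_inv _ _ (Hlt w Hw)). simpl. nra. }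
  pose proof (level_curve_strictly_increasing I Psi dPsi k HI HPsi Hk Hge Phi dPhi HPhi HJ)
    as Hmono.
  pose proof (level_height_unique I Psi dPsi k HPsi Hk Hge) as Huniq.
  pose proof (level_height_spec I Psi dPsi k HPsi Hk Hge) as Hspec.
  pose proof (level_curve_ivt I Psi dPsi k HI HPsi Hk Hge Phi dPhi HPhi) as Hivt.
  split.
  - intros [x1 y1] [x2 y2] H1 H2 E. simpl in H1, H2.
    assert (E1 : fst (Phi (x1, y1)) = fst (Phi (x2, y2))) by exact (f_equal fst E).
    assert (E2 : snd (Psi (x1, y1)) = snd (Psi (x2, y2))) by exact (f_equal snd E).
    pose proof (Huniq _ _ _ H1 E2) as Hy1.
    pose proof (Huniq _ _ _ H2 (eq_refl (snd (Psi (x2, y2))))) as Hy2.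
    rewrite Hy1 in E1. rewrite Hy2 in E1 at 2.
    destruct (Rtotal_order x1 x2) as [Hx|[Hx|Hx]].
    + specialize (Hmono (snd (Psi (x2, y2))) _ _ H1 H2 Hx). lra.
    + subst x2. congruence.
    + specialize (Hmono (snd (Psi (x2, y2))) _ _ H2 H1 Hx). lra.
  - intros [x1 y1] [x2 y2] u H1 H2 E Hu. simpl fst in H1, H2.
    change (snd (Psi (x1, y1)) = snd (Psi (x2, y2))) in E.
    change (fst (Phi (x1, y1)) <= u <= fst (Phi (x2, y2))) in Hu.
    change (exists w, I (fst w) /\ (H w + Cconj (G w))%X = (u, snd (Psi (x1, y1)))).
    set (c := snd (Psi (x1, y1))) in *.
    pose proof (Huniq c _ _ H1 eq_refl) as Hy1.
    pose proof (Huniq c _ _ H2 (eq_sym E)) as Hy2.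
    destruct (Req_dec u (fst (Phi (x1, y1)))) as [->|Hu1].
    { exists (x1, y1). split; [exact H1 | apply Cx_ext; reflexivity]. }
    destruct (Req_dec u (fst (Phi (x2, y2)))) as [->|Hu2].
    { exists (x2, y2). split; [exact H2 | apply Cx_ext; [reflexivity | now symmetry]]. }
    assert (Hx : x1 < x2).
    { apply Rnot_le_lt. intros [Hx|Hx].
      - specialize (Hmono c _ _ H2 H1 Hx). rewrite <- Hy1, <- Hy2 in Hmono. lra.
      - subst x2. rewrite Hy2, <- Hy1 in Hu. lra. }
    destruct (Hivt c x1 x2 u H1 H2 Hx) as [x [HIx Hxu]].
    { rewrite <- Hy1, <- Hy2. lra. }
    exists (x, level_height Psi c x). split; [exact HIx|].
    apply Cx_ext; [exact Hxu | exact (Hspec c x HIx)].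
Qed.

(** * Complex power series on the unit disk *)

Lemma has_sum_unique a z s t : has_sum a z s -> has_sum a z t -> s = t.
Proof.
  intros Hs Ht. apply Csub_eq_0, Cmod_le_0, Rnot_lt_le. intros Hpos.
  destruct (Hs (Cmod (s - t)%X / 2) ltac:(lra)) as [N1 H1].
  destruct (Ht (Cmod (s - t)%X / 2) ltac:(lra)) as [N2 H2].
  specialize (H1 (N1 + N2)%nat ltac:(lia)). specialize (H2 (N1 + N2)%nat ltac:(lia)).
  set (p := psum a z (N1 + N2)) in *.
  pose proof (Cmod_sub_le (p - t)%X (p - s)%X) as H.
  replace (p - t - (p - s))%X with (s - t)%X in H by ring. lra.
Qed.

Lemma Cps_eq a z s : has_sum a z s -> Cps a z = s.
Proof.
  intros H. apply (has_sum_unique a z); [|exact H].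
  unfold Cps. apply epsilon_spec. now exists s.
Qed.

Lemma Cps_has_sum a z : ps_on_D a -> inD z -> has_sum a z (Cps a z).
Proof. intros Ha Hz. unfold Cps. apply epsilon_spec. now apply Ha. Qed.

Lemma has_sum_lin a b z s t c d :
  has_sum a z s -> has_sum b z t ->
  has_sum (fun n => c * a n + d * b n)%X z (c * s + d * t)%X.
Proof.
  intros Hs Ht eps Heps.
  pose proof (Cmod_ge_0 c) as Hc. pose proof (Cmod_ge_0 d) as Hd.
  set (e := eps / (Cmod c + Cmod d + 1)).
  assert (He : 0 < e) by (apply Rdiv_lt_0_compat; lra).
  assert (Hee : e * (Cmod c + Cmod d + 1) = eps) by (unfold e; field; lra).
  destruct (Hs e He) as [N1 H1], (Ht e He) as [N2 H2].
  exists (N1 + N2)%nat. intros n Hn.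
  specialize (H1 n ltac:(lia)). specialize (H2 n ltac:(lia)).
  assert (E : psum (fun n => c * a n + d * b n)%X z n = (c * psum a z n + d * psum b z n)%X).
  { clear. induction n as [|n IH]; [reflexivity|].
    cbn [psum]. rewrite IH. ring. }
  rewrite E.
  replace (c * psum a z n + d * psum b z n - (c * s + d * t))%X
    with (c * (psum a z n - s) + d * (psum b z n - t))%X by ring.
  eapply Rle_lt_trans; [apply Cmod_add_le|]. rewrite !Cmod_mul.
  apply Rle_lt_trans with (Cmod c * e + Cmod d * e); [|lra].
  apply Rplus_le_compat; apply Rmult_le_compat_l; lra.
Qed.

Lemma has_sum_ext a b z s : (forall n, a n = b n) -> has_sum a z s -> has_sum b z s.
Proof.
  intros E H eps Heps. destruct (H eps Heps) as [N HN]. exists N. intros n Hn.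
  replace (psum b z n) with (psum a z n); [now apply HN|].
  clear -E. induction n as [|n IH]; cbn [psum]; [apply E | now rewrite IH, E].
Qed.

Lemma has_sum_scal a z s c : has_sum a z s -> has_sum (fun n => c * a n)%X z (c * s)%X.
Proof.
  intros H. replace (c * s)%X with (c * s + 0 * s)%X by ring.
  eapply has_sum_ext; [|apply (has_sum_lin a a z s s c 0%X H H)].
  intros n; simpl. ring.
Qed.

Lemma has_sum_rot a e z s :
  has_sum a (e * z)%X s -> has_sum (fun n => a n * e ^ n)%X z s.
Proof.
  intros H eps Heps. destruct (H eps Heps) as [N HN]. exists N. intros n Hn.
  replace (psum (fun n => a n * e ^ n)%X z n) with (psum a (e * z)%X n); [now apply HN|].
  assert (Epow : forall n, ((e * z) ^ n = e ^ n * z ^ n)%X).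
  { clear. induction n as [|n IH]; simpl; [ring | rewrite IH; ring]. }
  clear -Epow. induction n as [|n IH]; cbn [psum].
  - simpl. ring.
  - rewrite IH, Epow. ring.
Qed.

Lemma has_sum_0 a : has_sum a 0%X (a O).
Proof.
  intros eps Heps. exists O. intros n _.
  replace (psum a 0%X n) with (a O).
  - replace (a O - a O)%X with 0%X by ring. now rewrite Cmod_zero.
  - induction n as [|n IH]; cbn [psum]; [reflexivity|].
    rewrite <- IH. simpl. ring.
Qed.

Lemma has_sum_shift a z s :
  z <> 0%X -> has_sum a z s -> has_sum (fun n => a (S n)) z ((s - a O) / z)%X.
Proof.
  intros Hz H eps Heps. pose proof (Cmod_pos z Hz) as Hm.
  destruct (H (eps * Cmod z) (Rmult_lt_0_compat _ _ Heps Hm)) as [N HN].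
  exists N. intros n Hn. specialize (HN (S n) ltac:(lia)).
  assert (E : (psum a z (S n) - s)%X =
    (z * (psum (fun n => a (S n)) z n - (s - a O) / z))%X).
  { replace (psum a z (S n)) with (a O + z * psum (fun n => a (S n)) z n)%X.
    - field. exact Hz.
    - clear. induction n as [|n IH].
      + simpl. ring.
      + change (psum a z (S (S n))) with (psum a z (S n) + a (S (S n)) * z ^ S (S n))%X.
        rewrite <- IH. cbn [psum Cpow]. ring. }
  rewrite E, Cmod_mul in HN.
  apply Rmult_lt_reg_l with (Cmod z); [exact Hm | lra].
Qed.

Lemma has_sum_geometric z : inD z -> has_sum (fun _ => 1%X) z (1 / (1 - z))%X.
Proof.
  intros Hz eps Heps.
  assert (H1 : (1 - z)%X <> 0%X).
  { replace z with (1 * z)%X by ring. apply inD_sub_neq_0; [exact Hz | apply Cmod_one]. }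
  pose proof (Cmod_pos _ H1) as Hm.
  destruct (pow_lt_1_zero (Cmod z)
    ltac:(rewrite Rabs_pos_eq; [exact Hz | apply Cmod_ge_0])
    (eps * Cmod (1 - z)%X) (Rmult_lt_0_compat _ _ Heps Hm)) as [N HN].
  exists N. intros n Hn. specialize (HN (S n) ltac:(lia)).
  rewrite Rabs_pos_eq in HN by (apply pow_le, Cmod_ge_0).
  assert (E : (psum (fun _ => 1) z n - 1 / (1 - z))%X = (- (z ^ S n) / (1 - z))%X).
  { replace (psum (fun _ => 1%X) z n) with ((1 - z ^ S n) / (1 - z))%X.
    - field. exact H1.
    - clear -H1. induction n as [|n IH].
      + simpl. field. exact H1.
      + cbn [psum]. rewrite <- IH. cbn [Cpow]. field. exact H1. }
  rewrite E, Cmod_Cdiv, Cmod_opp, Cmod_Cpow by exact H1.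
  apply Rmult_lt_reg_r with (Cmod (1 - z)%X); [exact Hm|].
  unfold Rdiv. rewrite Rmult_assoc, Rinv_l by lra. lra.
Qed.

(** ** Absolute convergence *)

Definition cabs (a : nat -> Cx) (n : nat) : R := Cmod (a n).

Lemma psum_fst a z n : fst (psum a z n) = sum_n (fun k => fst (a k * z ^ k)%X) n.
Proof.
  induction n as [|n IH].
  - rewrite sum_O. simpl. ring.
  - rewrite sum_Sn, <- IH. reflexivity.
Qed.

Lemma psum_snd a z n : snd (psum a z n) = sum_n (fun k => snd (a k * z ^ k)%X) n.
Proof.
  induction n as [|n IH].
  - rewrite sum_O. simpl. ring.
  - rewrite sum_Sn, <- IH. reflexivity.
Qed.

Lemma ex_has_sum a z :
  ex_series (fun n => cabs a n * Cmod z ^ n) -> exists s, has_sum a z s.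
Proof.
  intros H.
  assert (H1 : ex_series (fun k => fst (a k * z ^ k)%X)).
  { eapply (@ex_series_le R_AbsRing R_CompleteNormedModule); [|exact H].
    intros n. unfold cabs. rewrite <- Cmod_Cpow, <- Cmod_mul. apply Cmod_fst. }
  assert (H2 : ex_series (fun k => snd (a k * z ^ k)%X)).
  { eapply (@ex_series_le R_AbsRing R_CompleteNormedModule); [|exact H].
    intros n. unfold cabs. rewrite <- Cmod_Cpow, <- Cmod_mul. apply Cmod_snd. }
  destruct H1 as [x Hx], H2 as [y Hy].
  assert (Lx : is_lim_seq (sum_n (fun k => fst (a k * z ^ k)%X)) x) by exact Hx.
  assert (Ly : is_lim_seq (sum_n (fun k => snd (a k * z ^ k)%X)) y) by exact Hy.
  apply is_lim_seq_Reals in Lx. apply is_lim_seq_Reals in Ly.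
  exists (x, y). intros eps Heps.
  destruct (Lx (eps / 2) ltac:(lra)) as [N1 HN1].
  destruct (Ly (eps / 2) ltac:(lra)) as [N2 HN2].
  exists (N1 + N2)%nat. intros n Hn.
  specialize (HN1 n ltac:(lia)). specialize (HN2 n ltac:(lia)).
  unfold Rdist in *. rewrite <- psum_fst in HN1. rewrite <- psum_snd in HN2.
  eapply Rle_lt_trans; [apply Cmod_le_abs|]. simpl. unfold Rminus in *. lra.
Qed.

(** Convergence at a real point [r < 1] bounds the terms there, which bounds the radius of the
    series of moduli from below by [r]. Convergence on the disk is thus absolute, and real power
    series can serve as majorants. *)
Lemma ps_on_D_radius a : ps_on_D a -> Rbar_le 1 (CV_radius (cabs a)).
Proof.
  intros Ha.
  assert (Hr : forall r, 0 <= r < 1 -> Rbar_le r (CV_radius (cabs a))).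
  { intros r Hr. apply CV_radius_bounded.
    assert (Hz : inD (RtoC r)).
    { unfold inD. rewrite Cmod_RtoC, Rabs_pos_eq; lra. }
    destruct (Ha _ Hz) as [s Hs]. destruct (Hs 1 Rlt_0_1) as [N HN].
    (* Two consecutive partial sums within 1 of [s] make a term of modulus at most 2. *)
    assert (Hb : forall n, (S N <= n)%nat -> Rabs (cabs a n * r ^ n) <= 2).
    { intros [|n] Hn; [lia|].
      pose proof (HN n ltac:(lia)) as B1. pose proof (HN (S n) ltac:(lia)) as B2.
      pose proof (Cmod_sub_le (psum a (RtoC r) (S n) - s)%X (psum a (RtoC r) n - s)%X) as B3.
      replace (psum a (RtoC r) (S n) - s - (psum a (RtoC r) n - s))%X
        with (a (S n) * RtoC r ^ S n)%X in B3 by (cbn [psum]; ring).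
      rewrite Cmod_mul, Cmod_Cpow, Cmod_RtoC, (Rabs_pos_eq r) in B3 by lra.
      rewrite Rabs_pos_eq; [unfold cabs; lra|].
      apply Rmult_le_pos; [apply Cmod_ge_0 | apply pow_le; lra]. }
    assert (Hfin : forall m, exists M, forall n, (n < m)%nat -> Rabs (cabs a n * r ^ n) <= M).
    { induction m as [|m [M HM]]; [exists 0; lia|].
      exists (Rmax M (Rabs (cabs a m * r ^ m))). intros n Hn.
      destruct (Nat.eq_dec n m) as [->|Hne]; [apply Rmax_r|].
      eapply Rle_trans; [apply HM; lia | apply Rmax_l]. }
    destruct (Hfin (S N)) as [M HM]. exists (Rmax M 2). intros n.
    destruct (Compare_dec.le_lt_dec (S N) n) as [Hn|Hn].
    - eapply Rle_trans; [now apply Hb | apply Rmax_r].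
    - eapply Rle_trans; [now apply HM | apply Rmax_l]. }
  destruct (CV_radius (cabs a)) as [R| |] eqn:E; simpl; [|exact I|].
  - apply Rnot_lt_le. intros HR.
    pose proof (CV_radius_ge_0 (cabs a)) as H0. rewrite E in H0. simpl in H0.
    specialize (Hr ((R + 1) / 2) ltac:(lra)). simpl in Hr. lra.
  - exact (Hr 0 ltac:(lra)).
Qed.

Lemma ex_series_in_radius (u : nat -> R) r :
  Rbar_le 1 (CV_radius u) -> 0 <= r < 1 -> ex_series (fun n => u n * r ^ n).
Proof.
  intros Hu Hr. apply ex_series_Rabs, CV_disk_inside.
  eapply Rbar_lt_le_trans; [|exact Hu]. simpl. rewrite Rabs_pos_eq; lra.
Qed.

Lemma radius_ps_on_D a : Rbar_le 1 (CV_radius (cabs a)) -> ps_on_D a.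
Proof.
  intros H z Hz. apply ex_has_sum, ex_series_in_radius; [exact H|].
  split; [apply Cmod_ge_0 | exact Hz].
Qed.

(** ** Termwise differentiation *)

Definition dps (a : nat -> Cx) (n : nat) : Cx := (RtoC (INR (S n)) * a (S n))%X.

Lemma cabs_dps a n : cabs (dps a) n = PS_derive (cabs a) n.
Proof.
  unfold cabs, dps, PS_derive. rewrite Cmod_mul, Cmod_RtoC.
  rewrite Rabs_pos_eq by apply pos_INR. reflexivity.
Qed.

Lemma dps_radius a : Rbar_le 1 (CV_radius (cabs a)) -> Rbar_le 1 (CV_radius (cabs (dps a))).
Proof.
  intros H. rewrite (CV_radius_ext _ _ (cabs_dps a)), CV_radius_derive. exact H.
Qed.

Lemma ps_on_D_dps a : ps_on_D a -> ps_on_D (dps a).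
Proof. intros Ha. now apply radius_ps_on_D, dps_radius, ps_on_D_radius. Qed.

(** Taylor remainder of a power. The factor 1/2 is given away so that the constants are the
    coefficients produced by differentiating twice, and the bounds sum to [PS_derive (PS_derive _)]
    at [r]. *)
Lemma pow_second_order w z r n :
  Cmod w <= r -> Cmod z <= r ->
  Cmod (w ^ S (S n) - z ^ S (S n) - RtoC (INR (S (S n))) * z ^ S n * (w - z))%X
    <= INR (S n) * INR (S (S n)) * r ^ n * Cmod (w - z)%X ^ 2.
Proof.
  intros Hw Hz. pose proof (Cmod_ge_0 w) as Hw0. pose proof (Cmod_ge_0 z) as Hz0.
  induction n as [|n IH].
  - replace (INR 2) with 2 by (simpl; ring).
    replace (w ^ 2 - z ^ 2 - RtoC 2 * z ^ 1 * (w - z))%X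
      with ((w - z) * (w - z))%X by ring.
    rewrite Cmod_mul. simpl INR. pose proof (Cmod_ge_0 (w - z)%X). simpl pow. nra.
  - set (m := S (S n)) in *.
    assert (E : (w ^ S m - z ^ S m - RtoC (INR (S m)) * z ^ m * (w - z))%X =
      (w * (w ^ m - z ^ m - RtoC (INR m) * z ^ S n * (w - z)) +
       RtoC (INR m) * z ^ S n * ((w - z) * (w - z)))%X).
    { rewrite (S_INR m), RtoC_add. unfold m at 1 2 4 5 6. cbn [Cpow].
      change (RtoC 1) with 1%X. ring. }
    rewrite E. eapply Rle_trans; [apply Cmod_add_le|].
    rewrite !Cmod_mul, Cmod_Cpow, Cmod_RtoC, Rabs_pos_eq by apply pos_INR.
    set (D := Cmod (w - z)%X) in *. assert (HD : 0 <= D) by apply Cmod_ge_0.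
    assert (Hm : 0 <= INR m) by apply pos_INR.
    assert (Hn : 0 <= INR (S n)) by apply pos_INR.
    assert (Hrn : 0 <= r ^ n) by (apply pow_le; lra).
    assert (P1 : Cmod w * Cmod (w ^ m - z ^ m - RtoC (INR m) * z ^ S n * (w - z))%X
      <= r * (INR (S n) * INR m * r ^ n * D ^ 2))
      by (apply Rmult_le_compat; auto using Cmod_ge_0).
    assert (P2 : Cmod z ^ S n <= r ^ S n) by (apply pow_incr; lra).
    assert (P3 : INR m * Cmod z ^ S n * (D * D) <= INR m * r ^ S n * (D * D)).
    { apply Rmult_le_compat_r; [nra|]. now apply Rmult_le_compat_l. }
    eapply Rle_trans; [apply Rplus_le_compat; [exact P1 | exact P3]|].
    rewrite (S_INR m). assert (Em : INR m = INR (S n) + 1) by apply S_INR.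
    rewrite Em in *. simpl pow.
    assert (0 <= r * r ^ n * (D * D)) by (apply Rmult_le_pos; nra).
    nra.
Qed.

Lemma psum_second_order a w z r n :
  Cmod w <= r -> Cmod z <= r ->
  Cmod (psum a w (S (S n)) - psum a z (S (S n)) - psum (dps a) z (S n) * (w - z))%X
    <= Cmod (w - z)%X ^ 2 * sum_n (fun k => PS_derive (PS_derive (cabs a)) k * r ^ k) n.
Proof.
  intros Hw Hz.
  assert (Hterm : forall m,
    Cmod (a (S (S m)) * (w ^ S (S m) - z ^ S (S m)
          - RtoC (INR (S (S m))) * z ^ S m * (w - z)))%X
      <= Cmod (w - z)%X ^ 2 * (PS_derive (PS_derive (cabs a)) m * r ^ m)).
  { intros m. rewrite Cmod_mul. eapply Rle_trans.
    - apply Rmult_le_compat_l; [apply Cmod_ge_0|]. apply pow_second_order; eassumption.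
    - unfold PS_derive, cabs. right. ring. }
  induction n as [|n IH].
  - rewrite sum_O. eapply Rle_trans; [|apply Hterm]. right. f_equal.
    unfold dps. cbn [psum Cpow]. change (RtoC (INR 1)) with 1%X. ring.
  - rewrite sum_Sn. change plus with Rplus.
    replace (psum a w (S (S (S n))) - psum a z (S (S (S n)))
               - psum (dps a) z (S (S n)) * (w - z))%X
      with ((psum a w (S (S n)) - psum a z (S (S n)) - psum (dps a) z (S n) * (w - z)) +
        a (S (S (S n))) * (w ^ S (S (S n)) - z ^ S (S (S n))
          - RtoC (INR (S (S (S n)))) * z ^ S (S n) * (w - z)))%X.
    2:{ set (m := S (S n)).
        change (psum a w (S m)) with (psum a w m + a (S m) * w ^ S m)%X.
        change (psum a z (S m)) with (psum a z m + a (S m) * z ^ S m)%X.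
        change (psum (dps a) z m) with
          (psum (dps a) z (S n) + RtoC (INR (S m)) * a (S m) * z ^ m)%X.
        ring. }
    eapply Rle_trans; [apply Cmod_add_le|].
    rewrite Rmult_plus_distr_l. apply Rplus_le_compat; [exact IH | apply Hterm].
Qed.

(** Partial sums satisfy a second-order bound with a constant [K] independent of their length,
    namely the twice derived majorant at a radius between [Cmod z] and 1. The bound passes to the
    limit. *)
Lemma cder_Cps a z : ps_on_D a -> inD z -> cder (Cps a) z (Cps (dps a) z).
Proof.
  intros Ha Hz eps Heps. unfold inD in Hz. pose proof (Cmod_ge_0 z) as Hz0.
  set (r := (1 + Cmod z) / 2).
  set (u := PS_derive (PS_derive (cabs a))).
  assert (Hex : ex_series (fun k => u k * r ^ k)).
  { apply ex_series_in_radius; [|unfold r; lra].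
    unfold u. rewrite !CV_radius_derive. now apply ps_on_D_radius. }
  destruct Hex as [K HK].
  assert (Hpos : forall k, 0 <= u k * r ^ k).
  { intros k. unfold u, PS_derive, cabs.
    repeat apply Rmult_le_pos; auto using pos_INR, Cmod_ge_0.
    apply pow_le. unfold r. lra. }
  assert (HsumK : forall n, sum_n (fun k => u k * r ^ k) n <= K).
  { apply is_lim_seq_incr_compare; [exact HK|]. intros n. rewrite sum_Sn.
    change plus with Rplus. pose proof (Hpos (S n)). lra. }
  assert (HK0 : 0 <= K).
  { eapply Rle_trans; [|apply (HsumK O)]. rewrite sum_O. apply Hpos. }
  exists (Rmin (r - Cmod z) (eps / (K + 1))).
  assert (Hq : 0 < eps / (K + 1)) by (apply Rdiv_lt_0_compat; lra).
  split; [apply Rmin_pos; [unfold r; lra | exact Hq]|].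
  intros w Hwz. split_Rmin.
  pose proof (Cmod_sub_ge w z).
  assert (Hwr : Cmod w <= r) by lra. assert (Hzr : Cmod z <= r) by (unfold r; lra).
  assert (HwD : inD w) by (unfold inD, r in *; lra).
  set (D := Cmod (w - z)%X) in *. assert (HD : 0 <= D) by apply Cmod_ge_0.
  apply Rle_trans with (D ^ 2 * K).
  2:{ assert (D * K <= eps); [|nra].
      assert (E : eps / (K + 1) * (K + 1) = eps) by (field; lra).
      rewrite <- E. apply Rmult_le_compat; lra. }
  (* Passage to the limit by contradiction: an excess [g] cannot be made up by three truncation
     errors below [e], with weights 1, 1 and [D], when [e * (D + 3) = g]. *)
  apply Rnot_lt_le. intros Hgap.
  set (g := Cmod (Cps a w - Cps a z - Cps (dps a) z * (w - z))%X - D ^ 2 * K).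
  set (e := g / (D + 3)).
  assert (He : 0 < e) by (apply Rdiv_lt_0_compat; unfold g; lra).
  assert (Heg : e * (D + 3) = g) by (unfold e; field; lra).
  destruct (Cps_has_sum a w Ha HwD e He) as [N1 Hs1].
  destruct (Cps_has_sum a z Ha Hz e He) as [N2 Hs2].
  destruct (Cps_has_sum (dps a) z (ps_on_D_dps a Ha) Hz e He) as [N3 Hs3].
  set (n := (N1 + N2 + N3)%nat).
  specialize (Hs1 (S (S n)) ltac:(lia)). specialize (Hs2 (S (S n)) ltac:(lia)).
  specialize (Hs3 (S n) ltac:(lia)).
  pose proof (psum_second_order a w z r n Hwr Hzr) as Hn. fold u D in Hn.
  assert (Hb : D ^ 2 * sum_n (fun k => u k * r ^ k) n <= D ^ 2 * K)
    by (apply Rmult_le_compat_l; [nra | apply HsumK]).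
  set (p1 := psum a w (S (S n))) in *. set (p2 := psum a z (S (S n))) in *.
  set (p3 := psum (dps a) z (S n)) in *.
  assert (Htri : Cmod (Cps a w - Cps a z - Cps (dps a) z * (w - z))%X <=
    Cmod (p1 - p2 - p3 * (w - z))%X + (Cmod (p1 - Cps a w)%X + Cmod (p2 - Cps a z)%X
       + Cmod (p3 - Cps (dps a) z)%X * D)).
  { replace (Cps a w - Cps a z - Cps (dps a) z * (w - z))%X
      with ((p1 - p2 - p3 * (w - z)) - ((p1 - Cps a w) - (p2 - Cps a z)
             - (p3 - Cps (dps a) z) * (w - z)))%X by ring.
    eapply Rle_trans; [apply Cmod_sub_le|]. apply Rplus_le_compat_l.
    eapply Rle_trans; [apply Cmod_sub_le|]. rewrite Cmod_mul. apply Rplus_le_compat_r.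
    apply Cmod_sub_le. }
  assert (Cmod (p3 - Cps (dps a) z)%X * D <= e * D)
    by (apply Rmult_le_compat_r; lra).
  unfold g in Heg. lra.
Qed.

(** ** Uniqueness of coefficients *)

Lemma ps_on_D_shift a : ps_on_D a -> ps_on_D (fun n => a (S n)).
Proof.
  intros Ha z Hz. destruct (Req_dec (Cmod z) 0) as [H0|H0].
  - assert (z = 0%X) as -> by (apply Cmod_le_0; lra).
    eexists. apply (has_sum_0 (fun n => a (S n))).
  - destruct (Ha z Hz) as [s Hs]. eexists. apply has_sum_shift; [|exact Hs].
    intros ->. apply H0, Cmod_zero.
Qed.

(** Induction through the shifted series. Division by [z] shows that it vanishes away from 0, and
    continuity of the shifted sum gives the value at 0. *)
Lemma Cps_zero_coef a :
  ps_on_D a -> (forall z, inD z -> Cps a z = 0%X) -> forall n, a n = 0%X.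
Proof.
  intros Ha Hz n. revert a Ha Hz. induction n as [|n IH]; intros a Ha Hz.
  - rewrite <- (Hz 0%X inD_0). symmetry. apply Cps_eq, has_sum_0.
  - apply (IH (fun n => a (S n)) (ps_on_D_shift a Ha)).
    assert (Ha0 : a O = 0%X).
    { rewrite <- (Hz 0%X inD_0). symmetry. apply Cps_eq, has_sum_0. }
    assert (Hpunct : forall z, inD z -> z <> 0%X -> Cps (fun n => a (S n)) z = 0%X).
    { intros z HzD Hz0. apply Cps_eq.
      replace 0%X with ((Cps a z - a O) / z)%X.
      - apply has_sum_shift; [exact Hz0 | now apply Cps_has_sum].
      - rewrite Hz, Ha0 by exact HzD. field. exact Hz0. }
    intros z HzD. destruct (Req_dec (Cmod z) 0) as [H0|H0].
    2:{ apply Hpunct; [exact HzD|]. intros ->. apply H0, Cmod_zero. }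
    assert (z = 0%X) as -> by (apply Cmod_le_0; lra).
    apply Cmod_le_0, Rnot_lt_le. intros Hpos.
    destruct (cder_continuous _ _ _
      (cder_Cps (fun n => a (S n)) 0%X (ps_on_D_shift a Ha) inD_0) _ Hpos) as [d [Hd H]].
    set (t := Rmin d 1 / 2).
    assert (Ht : 0 < t < d /\ t < 1).
    { unfold t. pose proof (Rmin_l d 1). pose proof (Rmin_r d 1).
      pose proof (Rmin_pos d 1 Hd Rlt_0_1). lra. }
    assert (Emod : Cmod (RtoC t) = t) by (rewrite Cmod_RtoC; apply Rabs_pos_eq; lra).
    specialize (H (RtoC t)). rewrite Hpunct in H.
    + replace (RtoC t - 0)%X with (RtoC t) in H by ring. rewrite Emod in H.
      specialize (H ltac:(lra)).
      match type of H with Cmod (0 - ?s)%X < _ =>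
        replace (0 - s)%X with (- s)%X in H by ring end.
      rewrite Cmod_opp in H. lra.
    + unfold inD. lra.
    + apply RtoC_neq_0. lra.
Qed.

Lemma Cps_lin a b c d z :
  ps_on_D a -> ps_on_D b -> inD z ->
  Cps (fun n => c * a n + d * b n)%X z = (c * Cps a z + d * Cps b z)%X.
Proof. intros Ha Hb Hz. apply Cps_eq, has_sum_lin; now apply Cps_has_sum. Qed.

Lemma ps_on_D_lin a b c d :
  ps_on_D a -> ps_on_D b -> ps_on_D (fun n => c * a n + d * b n)%X.
Proof.
  intros Ha Hb z Hz. destruct (Ha z Hz) as [s Hs], (Hb z Hz) as [t Ht].
  eexists. apply has_sum_lin; eassumption.
Qed.

Lemma Cps_coef_unique a b :
  ps_on_D a -> ps_on_D b -> (forall z, inD z -> Cps a z = Cps b z) ->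
  forall n, a n = b n.
Proof.
  intros Ha Hb H n.
  assert (E : (1 * a n + - (1) * b n)%X = 0%X).
  { apply (Cps_zero_coef (fun n => 1 * a n + - (1) * b n)%X).
    - now apply ps_on_D_lin.
    - intros z Hz. rewrite Cps_lin, H by assumption. ring. }
  apply Csub_eq_0. rewrite <- E. ring.
Qed.

(** The Euler operator [z d/dz] multiplies the coefficient of index [n] by [n]; through it a factor
    affine in the index becomes a derivative. *)
Lemma has_sum_Euler a z s :
  has_sum (dps a) z s -> has_sum (fun n => RtoC (INR n) * a n)%X z (z * s)%X.
Proof.
  intros H eps Heps.
  destruct (H (eps / (Cmod z + 1))) as [N HN].
  { apply Rdiv_lt_0_compat; [exact Heps|]. pose proof (Cmod_ge_0 z). lra. }
  exists (S N). intros [|n] Hn; [lia|]. specialize (HN n ltac:(lia)).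
  assert (E : (psum (fun n => RtoC (INR n) * a n)%X z (S n) = z * psum (dps a) z n)%X).
  { clear. induction n as [|n IH].
    - unfold dps. cbn [psum Cpow]. change (RtoC (INR 0)) with 0%X. ring.
    - change (psum (fun n => RtoC (INR n) * a n)%X z (S (S n))) with
        (psum (fun n => RtoC (INR n) * a n)%X z (S n)
          + RtoC (INR (S (S n))) * a (S (S n)) * z ^ S (S n))%X.
      rewrite IH. unfold dps. cbn [psum Cpow]. ring. }
  rewrite E. replace (z * psum (dps a) z n - z * s)%X with (z * (psum (dps a) z n - s))%X by ring.
  rewrite Cmod_mul. pose proof (Cmod_ge_0 z) as Hz0.
  assert (E2 : (Cmod z + 1) * (eps / (Cmod z + 1)) = eps) by (field; lra).
  pose proof (Cmod_ge_0 (psum (dps a) z n - s)%X). nra.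
Qed.

(** * Convolution with a half-plane map *)

(** [1 / quad c] is the derivative of a conformal map of the disk: [v / (1 - v)], onto a half-plane,
    for [c = -1], and the logarithmic map onto a strip for [c = cos b]. One argument thus serves
    both cases. *)
Definition quad (c : R) (v : Cx) : Cx := (1 + RtoC (2 * c) * v + v * v)%X.

Lemma fst_RtoC_mul x z : fst (RtoC x * z)%X = x * fst z.
Proof. simpl. ring. Qed.

Lemma fst_cayley_pos om : Cmod om < 1 -> 0 < fst ((1 - om) / (1 + om))%X.
Proof.
  destruct om as [x y]. intros H.
  rewrite <- Cmod_one in H. apply Cmod_lt_sq_inv in H. simpl in H.
  assert (0 < (1 + x) * ((1 + x) * 1) + (0 + y) * ((0 + y) * 1)) by nra.
  simpl. unfold Rdiv.
  match goal with |- 0 < ?e =>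
    replace e with ((1 - x * x - y * y) / ((1 + x) * ((1 + x) * 1) + (0 + y) * ((0 + y) * 1)))
      by (field; lra) end.
  apply Rdiv_lt_0_compat; lra.
Qed.

(** The number [d >= 0] and [Z] lie on the same side of the imaginary axis, so [Z] is no farther
    from [d] than from [- d]; the factor [om] makes the inequality strict. *)
Lemma Cmod_reflect_lt om Z d :
  Cmod om < 1 -> 0 <= d -> 0 < fst Z ->
  Cmod (om * (RtoC d - Z))%X < Cmod (RtoC d + Z)%X.
Proof.
  intros Hom Hd HZ. rewrite Cmod_mul.
  assert (Hpos : 0 < Cmod (RtoC d + Z)%X).
  { apply Cmod_pos. intros E. apply (f_equal fst) in E. simpl in E. lra. }
  assert (Hle : Cmod (RtoC d - Z)%X <= Cmod (RtoC d + Z)%X).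
  { apply sqrt_le_1_alt. simpl. nra. }
  pose proof (Cmod_ge_0 om). pose proof (Cmod_ge_0 (RtoC d - Z)%X). nra.
Qed.

Lemma dilatation_lt_1 theta n v :
  (0 < n)%nat -> inD v -> Cmod (Cexpi theta * v ^ n)%X < 1.
Proof.
  intros Hn Hv. rewrite Cmod_mul, Cmod_Cexpi, Cmod_Cpow, Rmult_1_l.
  unfold inD in Hv. pose proof (Cmod_ge_0 v).
  destruct n as [|n]; [lia|]. simpl.
  assert (Cmod v ^ n <= 1) by (rewrite <- (pow1 n); apply pow_incr; lra).
  pose proof (pow_le (Cmod v) n ltac:(assumption)). nra.
Qed.

(** With [q := (1 - om) / (1 + om)], [P := (1 - v * v) / quad c v] and
    [Z := P + (n / 2) * q], the derivatives of the analytic and co-analytic parts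
    in the coordinate [w] are [lam (1 - a) (d + Z) / (1 + om)] and
    [lam (1 - a) om (d - Z) / (1 + om)], where [d := (1 + a) / (1 - a) - n / 2];
    the bound relating [a] and [n] says exactly that [d >= 0]. *)
Lemma shear_convex (I : R -> Prop) (k : R -> R) (V : Cx -> Cx) (c lam a theta : R)
    (n : nat) (h g h1 g1 : Cx -> Cx) :
  open_interval I -> 0 < lam ->
  (forall w, I (fst w) -> inD (V w)) ->
  (forall w, I (fst w) -> cder V w (RtoC lam * quad c (V w))%X) ->
  (forall x, I x -> 0 < k x) ->
  (forall w, I (fst w) -> k (fst w) <= fst ((1 - V w * V w) / quad c (V w))%X) ->
  (forall v, inD v -> exists w, I (fst w) /\ V w = v) ->
  (forall v, inD v -> quad c v <> 0%X) ->
  (forall v, inD v -> cder h v (h1 v)) ->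
  (forall v, inD v -> cder g v (g1 v)) ->
  (forall v, inD v -> (h1 v + g1 v)%X = (1 / quad c v)%X) ->
  (forall v, inD v -> g1 v = (Cexpi theta * v ^ n * h1 v)%X) ->
  (0 < n)%nat -> -1 < a < 1 -> (1 - a) * INR n <= 2 * (1 + a) ->
  let F v := ((RtoC (1 + a) * h v + RtoC (1 - a) * (v * h1 v)) +
              Cconj (RtoC (1 + a) * g v - RtoC (1 - a) * (v * g1 v)))%X in
  (forall v1 v2, inD v1 -> inD v2 -> F v1 = F v2 -> v1 = v2) /\
  (forall v1 v2 u, inD v1 -> inD v2 -> snd (F v1) = snd (F v2) ->
     fst (F v1) <= u <= fst (F v2) ->
     exists v, inD v /\ F v = (u, snd (F v1))).
Proof.
  intros HI Hlam HVD HV Hk HP Honto HQ Hh Hg Hsum Hdil Hn Ha Hbound F.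
  set (om := fun v => (Cexpi theta * v ^ n)%X) in *.
  assert (Hom : forall v, inD v -> Cmod (om v) < 1)
    by (intros; now apply dilatation_lt_1).
  assert (Hom1 : forall v, inD v -> (1 + om v)%X <> 0%X).
  { intros v Hv. apply Cmod_pos_neq.
    pose proof (Cmod_sub_ge 1%X (- om v)%X) as Hge. specialize (Hom v Hv).
    rewrite Cmod_opp, Cmod_one in Hge.
    replace (1 - - om v)%X with (1 + om v)%X in Hge by ring. lra. }
  assert (Hh1 : forall v, inD v -> h1 v = (1 / (quad c v * (1 + om v)))%X).
  { intros v Hv. specialize (Hsum v Hv). rewrite (Hdil v Hv) in Hsum.
    change (Cexpi theta * v ^ n)%X with (om v) in Hsum.
    replace (h1 v) with ((h1 v + om v * h1 v) / (1 + om v))%X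
      by (field; now apply Hom1).
    rewrite Hsum. field. auto. }
  (* [v * h1 v] in closed form: differentiating it takes only the derivatives of [quad c] and
     [om]. *)
  set (vh := fun v => (v / quad c v * Cinv (1 + om v))%X).
  set (vg := fun v => (v / quad c v - vh v)%X).
  assert (Evh : forall v, inD v -> vh v = (v * h1 v)%X).
  { intros v Hv. unfold vh. rewrite Hh1 by exact Hv. field. auto. }
  assert (Evg : forall v, inD v -> vg v = (v * g1 v)%X).
  { intros v Hv. unfold vg. rewrite Evh by exact Hv.
    replace (g1 v) with ((h1 v + g1 v) - h1 v)%X by ring. rewrite Hsum by exact Hv.
    field. auto. }
  set (N := RtoC (INR n)).
  (* Euler's identity for the monomial [om], the source of the exponent in the bound on [a]. *)
  assert (Hdom : forall v, exists l, cder om v l /\ (v * l)%X = (N * om v)%X).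
  { intros v. unfold om, N. destruct n as [|m]; [lia|]. eexists. split.
    - apply (cder_scal _ (fun v => v ^ S m)%X), cder_pow.
    - simpl Cpow. ring. }
  assert (Hdq : forall v, inD v ->
    cder (fun v => v / quad c v)%X v ((1 - v * v) / (quad c v * quad c v))%X).
  { intros v Hv. eapply cder_eq.
    - apply (cder_div (fun v => v) (quad c)); [apply cder_id| |now apply HQ].
      unfold quad. apply cder_add; [apply cder_add; [apply cder_const|]|].
      + apply cder_scal, cder_id.
      + apply cder_mul; apply cder_id.
    - simpl. pose proof (HQ v Hv) as Hq. unfold quad in *. field. exact Hq. }
  set (T := fun v => Cinv (1 + om v)%X).
  set (P := fun v => ((1 - v * v) / quad c v)%X).
  set (dvh := fun v => ((P v * T v - N * om v * (T v * T v)) / quad c v)%X).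
  assert (Hdvh : forall v, inD v -> cder vh v (dvh v)).
  { intros v Hv. destruct (Hdom v) as [l [Hl El]]. eapply cder_eq.
    - apply (cder_mul (fun v => v / quad c v)%X (fun v => Cinv (1 + om v))%X);
        [now apply Hdq|].
      apply (cder_comp (fun v => 1 + om v)%X Cinv); [|now apply cder_Cinv, Hom1].
      apply (cder_add (fun _ => 1%X)); [apply cder_const | exact Hl].
    - unfold dvh, P, T.
      replace (N * om v)%X with (v * l)%X by exact El.
      simpl. field. auto. }
  set (dvg := fun v => ((1 - v * v) / (quad c v * quad c v) - dvh v)%X).
  assert (Hdvg : forall v, inD v -> cder vg v (dvg v)).
  { intros v Hv. unfold vg. apply cder_sub; [now apply Hdq | now apply Hdvh]. }
  set (H := fun w => (RtoC (1 + a) * h (V w) + RtoC (1 - a) * vh (V w))%X).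
  set (G := fun w => (RtoC (1 + a) * g (V w) - RtoC (1 - a) * vg (V w))%X).
  (* The factor [quad c (V w)] in the derivative of [V] cancels the denominator common to [h1],
     [g1], [dvh] and [dvg]. *)
  set (dH := fun v => (RtoC lam *
    (RtoC (1 + a) * T v + RtoC (1 - a) * (P v * T v - N * om v * (T v * T v))))%X).
  set (dG := fun v => (RtoC lam * (RtoC (1 + a) * (1 - T v)
    - RtoC (1 - a) * (P v - P v * T v + N * om v * (T v * T v))))%X).
  assert (HH : forall w, I (fst w) -> cder H w (dH (V w))).
  { intros w Hw. pose proof (HVD w Hw) as Hv. pose proof (HQ _ Hv) as Hq.
    eapply cder_eq.
    - apply cder_add; apply cder_scal.
      + apply (cder_comp V h); [now apply HV | now apply Hh].
      + apply (cder_comp V vh); [now apply HV | now apply Hdvh].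
    - unfold dH, dvh. rewrite Hh1 by exact Hv.
      replace (1 / (quad c (V w) * (1 + om (V w))))%X with (T (V w) / quad c (V w))%X
        by (unfold T; field; auto).
      field. exact Hq. }
  assert (HG : forall w, I (fst w) -> cder G w (dG (V w))).
  { intros w Hw. pose proof (HVD w Hw) as Hv. pose proof (HQ _ Hv) as Hq.
    eapply cder_eq.
    - apply cder_sub; apply cder_scal.
      + apply (cder_comp V g); [now apply HV | now apply Hg].
      + apply (cder_comp V vg); [now apply HV | now apply Hdvg].
    - unfold dG, dvg, dvh.
      replace (g1 (V w)) with ((h1 (V w) + g1 (V w)) - h1 (V w))%X by ring.
      rewrite Hsum, Hh1 by exact Hv.
      replace (1 / (quad c (V w) * (1 + om (V w))))%X with (T (V w) / quad c (V w))%X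
        by (unfold T; field; auto).
      unfold P. field. exact Hq. }
  assert (Hq : forall v, inD v -> 0 < fst (RtoC 2 * T v - 1)%X).
  { intros v Hv. pose proof (fst_cayley_pos _ (Hom v Hv)) as Hp.
    replace (RtoC 2 * T v - 1)%X with ((1 - om v) / (1 + om v))%X
      by (unfold T; field; auto).
    exact Hp. }
  (* The bound keeps the contribution of [P] only. The other term of [dH - dG] is a positive
     multiple of [2 T - 1 = (1 - om) / (1 + om)], of positive real part. *)
  destruct (shear_principle I (fun x => lam * ((1 - a) * k x)) H G
    (fun w => dH (V w)) (fun w => dG (V w)) HI HH HG) as [Hinj Hconv].
  - intros x Hx. specialize (Hk x Hx). apply Rmult_lt_0_compat; [lra|].
    apply Rmult_lt_0_compat; lra.
  - intros w Hw. pose proof (HVD w Hw) as Hv.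
    replace (dH (V w) - dG (V w))%X with
      (RtoC lam * (RtoC (1 + a) * (RtoC 2 * T (V w) - 1) + RtoC (1 - a) * P (V w)))%X
      by (unfold dH, dG; ring).
    rewrite fst_RtoC_mul. apply Rmult_le_compat_l; [lra|].
    change (fst (?x + ?y)%X) with (fst x + fst y). rewrite !fst_RtoC_mul.
    specialize (HP w Hw). fold (P (V w)) in HP. specialize (Hq _ Hv).
    assert ((1 - a) * k (fst w) <= (1 - a) * fst (P (V w)))
      by (apply Rmult_le_compat_l; lra).
    assert (0 < (1 + a) * fst (RtoC 2 * T (V w) - 1)%X)
      by (apply Rmult_lt_0_compat; lra).
    lra.
  - intros w Hw. pose proof (HVD w Hw) as Hv. set (v := V w) in *.
    set (d := (1 + a) / (1 - a) - INR n / 2).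
    set (Z := (P v + RtoC (INR n / 2) * (RtoC 2 * T v - 1))%X).
    assert (Hd : 0 <= d).
    { unfold d. apply Rmult_le_reg_l with (2 * (1 - a)); [lra|].
      rewrite Rmult_0_r. unfold Rdiv.
      replace (2 * (1 - a) * ((1 + a) * / (1 - a) - INR n * / 2))
        with (2 * (1 + a) - (1 - a) * INR n) by (field; lra). lra. }
    assert (HZ : 0 < fst Z).
    { unfold Z. change (fst (?x + ?y)%X) with (fst x + fst y). rewrite fst_RtoC_mul.
      specialize (HP w Hw). fold v in HP. fold (P v) in HP. specialize (Hk _ Hw).
      specialize (Hq _ Hv). pose proof (pos_INR n).
      assert (0 <= INR n / 2 * fst (RtoC 2 * T v - 1)%X)
        by (apply Rmult_le_pos; lra). lra. }
    pose proof (Cmod_reflect_lt (om v) Z d (Hom v Hv) Hd HZ) as Hlt.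
    assert (Ea : RtoC (1 + a) = (RtoC (1 - a) * (RtoC (INR n / 2) + RtoC d))%X).
    { rewrite <- RtoC_add, <- RtoC_mul. f_equal. unfold d. field. lra. }
    assert (EN : N = (RtoC 2 * RtoC (INR n / 2))%X).
    { unfold N. rewrite <- RtoC_mul. f_equal. field. }
    assert (EH : dH v = (RtoC lam * RtoC (1 - a) * T v * (RtoC d + Z))%X).
    { unfold dH, Z. rewrite Ea, EN. unfold T. field. auto. }
    assert (EG : dG v = (RtoC lam * RtoC (1 - a) * T v * (om v * (RtoC d - Z)))%X).
    { unfold dG, Z. rewrite Ea, EN. unfold T. field. auto. }
    rewrite EH, EG, (Cmod_mul _ (om v * (RtoC d - Z))%X), (Cmod_mul _ (RtoC d + Z)%X).
    apply Rmult_lt_compat_l; [|exact Hlt].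
    unfold T. rewrite !Cmod_mul, !Cmod_RtoC, Cmod_Cinv by auto.
    rewrite !Rabs_pos_eq by lra.
    pose proof (Rinv_0_lt_compat _ (Cmod_pos _ (Hom1 v Hv))).
    repeat apply Rmult_lt_0_compat; lra.
  - assert (EF : forall w, I (fst w) -> F (V w) = (H w + Cconj (G w))%X).
    { intros w Hw. unfold F, H, G.
      rewrite Evh, Evg by (now apply HVD). reflexivity. }
    split.
    + intros v1 v2 Hv1 Hv2 E.
      destruct (Honto v1 Hv1) as [w1 [Hw1 <-]], (Honto v2 Hv2) as [w2 [Hw2 <-]].
      rewrite !EF in E by assumption. f_equal. now apply Hinj.
    + intros v1 v2 u Hv1 Hv2 E Hu.
      destruct (Honto v1 Hv1) as [w1 [Hw1 <-]], (Honto v2 Hv2) as [w2 [Hw2 <-]].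
      rewrite !EF in E by assumption. rewrite !EF in Hu by assumption.
      destruct (Hconv w1 w2 u Hw1 Hw2 E Hu) as [w [Hw Ew]].
      exists (V w). split; [now apply HVD|]. rewrite !EF by assumption. exact Ew.
Qed.

(** * Coefficients of the half-plane map *)

Lemma dilatation_dps a b om z :
  ps_on_D a -> ps_on_D b -> dilatation_is a b om -> inD z ->
  Cps (dps b) z = (om z * Cps (dps a) z)%X.
Proof.
  intros Ha Hb Hd Hz. destruct (Hd z Hz) as [hd [gd [Hh [Hg [Hne E]]]]].
  rewrite <- (cder_unique _ _ _ _ (Cderiv_cder _ _ _ Hh) (cder_Cps a z Ha Hz)).
  rewrite <- (cder_unique _ _ _ _ (Cderiv_cder _ _ _ Hg) (cder_Cps b z Hb Hz)).
  rewrite <- E. field. exact Hne.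
Qed.

Lemma cder_1_sub e z : cder (fun w => 1 - e * w)%X z (- e)%X.
Proof.
  eapply cder_eq; [apply cder_sub; [apply cder_const | apply cder_scal, cder_id]|].
  ring.
Qed.

(** Together these two rational functions span the derivatives [h1'] and [g1'] of the half-plane
    map. The factor 1 in [G] matches the shape given by [has_sum_rot]. *)
Lemma Cps_geometric_derivatives e z :
  Cmod e = 1 -> inD z ->
  let G := fun n => (1 * e ^ n)%X in
  ps_on_D G /\
  Cps (dps G) z = (e / ((1 - e * z) * (1 - e * z)))%X /\
  Cps (dps (dps G)) z =
    (RtoC 2 * (e * e) / ((1 - e * z) * (1 - e * z) * (1 - e * z)))%X.
Proof.
  intros He Hz G.
  assert (Hsum : forall z, inD z -> has_sum G z (1 / (1 - e * z))%X).
  { intros w Hw. apply has_sum_rot, has_sum_geometric.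
    unfold inD. rewrite Cmod_mul, He, Rmult_1_l. exact Hw. }
  assert (HG : ps_on_D G) by (intros w Hw; eexists; now apply Hsum).
  assert (Hne : forall w, inD w -> (1 - e * w)%X <> 0%X)
    by (intros; now apply inD_sub_neq_0).
  assert (E1 : forall w, inD w ->
    Cps (dps G) w = (e / ((1 - e * w) * (1 - e * w)))%X).
  { intros w Hw. apply (cder_unique (Cps G) w); [now apply cder_Cps|].
    apply (cder_ext_D (fun w => 1 / (1 - e * w))%X); [exact Hw| |].
    - intros x Hx. symmetry. now apply Cps_eq, Hsum.
    - eapply cder_eq.
      + apply (cder_div (fun _ => 1%X) (fun w => 1 - e * w)%X);
          [apply cder_const | apply cder_1_sub | now apply Hne].
      + simpl. field. now apply Hne. }
  split; [exact HG|]. split; [now apply E1|].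
  apply (cder_unique (Cps (dps G)) z); [now apply cder_Cps, Hz; apply ps_on_D_dps|].
  apply (cder_ext_D (fun w => e / ((1 - e * w) * (1 - e * w)))%X); [exact Hz| |].
  - intros x Hx. symmetry. now apply E1.
  - eapply cder_eq.
    + apply (cder_div (fun _ => e) (fun w => (1 - e * w) * (1 - e * w))%X).
      * apply cder_const.
      * apply cder_mul; apply cder_1_sub.
      * intros E. apply (Hne z Hz), (Cmul_integral _ _ E), Hne, Hz.
    + simpl. field. now apply Hne.
Qed.

(** The two derived geometric series have coefficients [(n + 1) e^(n + 1)] and
    [(n + 1) (n + 2) e^(n + 2)]; dividing by [n + 1] leaves an affine function of the index. *)
Lemma dps_coef (A : nat -> Cx) e x y n :
  e <> 0%X ->
  dps A n = (x * dps (fun n => 1 * e ^ n)%X n + y * dps (dps (fun n => 1 * e ^ n)%X) n)%X ->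
  A (S n) = (e ^ S n * (x + y * e * RtoC (INR (S n)) + y * e))%X.
Proof.
  intros He E. unfold dps in E.
  assert (HS : RtoC (INR (S n)) <> 0%X).
  { apply RtoC_neq_0, not_0_INR. lia. }
  assert (E2 : RtoC (INR (S (S n))) = (RtoC (INR (S n)) + 1)%X)
    by (rewrite (S_INR (S n)), RtoC_add; reflexivity).
  rewrite E2 in E.
  replace (A (S n)) with (RtoC (INR (S n)) * A (S n) / RtoC (INR (S n)))%X
    by (field; exact HS).
  rewrite E. simpl Cpow. field. exact HS.
Qed.

(** Partial fractions: [h1' = (1 - a u) / (1 - u)^3] and
    [g1' = e^(2 i phi) (a - u) / (1 - u)^3] with [u := e^(i phi) z]. *)
Lemma half_plane_map_coefs (a phi : R) (A B : nat -> Cx) :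
  -1 < a < 1 -> ps_on_D A -> ps_on_D B ->
  (forall z, inD z ->
     Cadd (Cps A z) (Cmul (Cexpi (- 2 * phi)) (Cps B z)) =
     Cdiv (Cmul (RtoC (1 + a)) z) (Csub Cone (Cmul (Cexpi phi) z))) ->
  dilatation_is A B (fun z =>
     Cmul (Cexpi (2 * phi))
       (Cdiv (Csub (RtoC a) (Cmul z (Cexpi phi)))
             (Csub Cone (Cmul (RtoC a) (Cmul z (Cexpi phi)))))) ->
  forall n, let e := Cexpi phi in
    A (S n) = (e ^ S n * (Cinv (RtoC 2 * e)
                 * (RtoC (1 - a) * RtoC (INR (S n)) + RtoC (1 + a))))%X /\
    B (S n) = (e ^ S n * (e / RtoC 2
                 * (RtoC (1 + a) - RtoC (1 - a) * RtoC (INR (S n)))))%X.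
Proof.
  intros Ha HA HB Hsum Hdil n e.
  assert (He : Cmod e = 1) by apply Cmod_Cexpi.
  assert (He0 : e <> 0%X) by apply Cexpi_neq_0.
  assert (H20 : RtoC 2 <> 0%X) by (apply RtoC_neq_0; lra).
  set (G := fun n => (1 * e ^ n)%X).
  assert (HG : ps_on_D G) by exact (proj1 (Cps_geometric_derivatives e 0%X He inD_0)).
  pose proof (ps_on_D_dps G HG) as HG1. pose proof (ps_on_D_dps _ HG1) as HG2.
  assert (E2 : Cexpi (2 * phi) = (e * e)%X) by apply Cexpi_double.
  assert (Em2 : Cexpi (- 2 * phi) = Cinv (e * e)%X).
  { rewrite <- E2, <- Cexpi_opp. f_equal. ring. }
  assert (Hder : forall z, inD z ->
    (Cps (dps A) z + Cinv (e * e) * Cps (dps B) z)%X =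
    (RtoC (1 + a) / ((1 - e * z) * (1 - e * z)))%X).
  { intros z Hz.
    apply (cder_unique (fun z => Cps A z + Cinv (e * e) * Cps B z)%X z).
    - apply cder_add; [|apply cder_scal]; now apply cder_Cps.
    - apply (cder_ext_D (fun z => RtoC (1 + a) * z / (1 - e * z))%X); [exact Hz| |].
      + intros w Hw. symmetry. rewrite <- Em2. now apply Hsum.
      + eapply cder_eq.
        * apply cder_div; [apply cder_scal, cder_id | apply cder_1_sub|].
          now apply inD_sub_neq_0.
        * simpl. field. now apply inD_sub_neq_0. }
  assert (Eboth : forall z, inD z ->
    Cps (dps A) z = ((1 - RtoC a * (e * z)) / ((1 - e * z) * (1 - e * z) * (1 - e * z)))%X /\
    Cps (dps B) z =
      (e * e * (RtoC a - e * z) / ((1 - e * z) * (1 - e * z) * (1 - e * z)))%X).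
  { intros z Hz. pose proof (Hder z Hz) as Hd.
    pose proof (inD_sub_neq_0 z e Hz He) as H1.
    assert (H2 : (1 - RtoC a * (e * z))%X <> 0%X).
    { apply Cmod_pos_neq. pose proof (Cmod_sub_ge 1%X (RtoC a * (e * z))%X) as Hge.
      rewrite !Cmod_mul, Cmod_one, He, Cmod_RtoC in Hge.
      assert (Rabs a < 1) by (apply Rabs_def1; lra).
      unfold inD in Hz. pose proof (Cmod_ge_0 z). pose proof (Rabs_pos a). nra. }
    assert (H3 : RtoC (1 + a) <> 0%X) by (apply RtoC_neq_0; lra).
    assert (Edil : Cps (dps B) z =
      (e * e * ((RtoC a - e * z) / (1 - RtoC a * (e * z))) * Cps (dps A) z)%X).
    { rewrite (dilatation_dps A B _ z HA HB Hdil Hz), E2. fold e.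
      replace (z * e)%X with (e * z)%X by ring. reflexivity. }
    rewrite Edil in Hd.
    assert (EA : Cps (dps A) z =
      ((1 - RtoC a * (e * z)) / ((1 - e * z) * (1 - e * z) * (1 - e * z)))%X).
    (* With [u = e z], [1 + (a - u) / (1 - a u) = (1 + a) (1 - u) / (1 - a u)], so the sum of the
       derivatives determines the first one. *)
    { replace (Cps (dps A) z) with
        ((Cps (dps A) z + Cinv (e * e) *
          (e * e * ((RtoC a - e * z) / (1 - RtoC a * (e * z))) * Cps (dps A) z))
          * ((1 - RtoC a * (e * z)) / (RtoC (1 + a) * (1 - e * z))))%X.
      - rewrite Hd. field. auto.
      - rewrite RtoC_add in *. change (RtoC 1) with 1%X in *. field. auto. }
    split; [exact EA|]. rewrite Edil, EA. field. auto. }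
  (* The weights come from [1 - a u = a (1 - u) + (1 - a)] here and from [a - u = (1 - u) - (1 - a)]
     for [B]. *)
  assert (HdA : dps A n = (RtoC a / e * dps G n
      + RtoC (1 - a) / (RtoC 2 * (e * e)) * dps (dps G) n)%X).
  { apply (Cps_coef_unique (dps A)
      (fun n => RtoC a / e * dps G n + RtoC (1 - a) / (RtoC 2 * (e * e)) * dps (dps G) n)%X).
    - now apply ps_on_D_dps.
    - now apply ps_on_D_lin.
    - intros z Hz. rewrite Cps_lin by assumption.
      destruct (Cps_geometric_derivatives e z He Hz) as [_ [D1 D2]].
      fold G in D1, D2. rewrite D1, D2.
      destruct (Eboth z Hz) as [-> _]. pose proof (inD_sub_neq_0 z e Hz He).
      rewrite RtoC_sub. change (RtoC 1) with 1%X. field. auto. }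
  assert (HdB : dps B n = (e * dps G n
      + - RtoC (1 - a) / RtoC 2 * dps (dps G) n)%X).
  { apply (Cps_coef_unique (dps B)
      (fun n => e * dps G n + - RtoC (1 - a) / RtoC 2 * dps (dps G) n)%X).
    - now apply ps_on_D_dps.
    - now apply ps_on_D_lin.
    - intros z Hz. rewrite Cps_lin by assumption.
      destruct (Cps_geometric_derivatives e z He Hz) as [_ [D1 D2]].
      fold G in D1, D2. rewrite D1, D2.
      destruct (Eboth z Hz) as [_ ->]. pose proof (inD_sub_neq_0 z e Hz He).
      rewrite RtoC_sub. change (RtoC 1) with 1%X. field. auto. }
  apply dps_coef in HdA; [|exact He0]. apply dps_coef in HdB; [|exact He0].
  rewrite HdA, HdB, RtoC_add, RtoC_sub. change (RtoC 1) with 1%X.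
  split; field; auto.
Qed.

(** * The convolution expressed through the second map *)

(** The factor [e ^ n] rotates the argument, and the affine factor combines the identity with the
    Euler operator. The formula for [A] starts at index 1; the term of index 0 vanishes because
    [X O = 0]. *)
Lemma Cps_hconv_affine (A X : nat -> Cx) (e q r s z : Cx) :
  ps_on_D X -> X O = 0%X -> Cmod e = 1 -> inD z ->
  (forall n, A (S n) = (e ^ S n * (q * (r * RtoC (INR (S n)) + s)))%X) ->
  Cps (hconv A X) z =
    (q * (r * (e * z * Cps (dps X) (e * z)) + s * Cps X (e * z)))%X.
Proof.
  intros HX HX0 He Hz HA.
  assert (Hez : inD (e * z)%X) by (unfold inD; rewrite Cmod_mul, He, Rmult_1_l; exact Hz).
  apply Cps_eq.
  apply (has_sum_ext (fun n => q * (r * (RtoC (INR n) * X n) + s * X n) * e ^ n)%X).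
  - intros [|n]; unfold hconv; [rewrite HX0 | rewrite HA]; ring.
  - apply (has_sum_rot (fun n => q * (r * (RtoC (INR n) * X n) + s * X n))%X).
    apply has_sum_scal, has_sum_lin.
    + apply has_sum_Euler, Cps_has_sum; [now apply ps_on_D_dps | exact Hez].
    + now apply Cps_has_sum.
Qed.

Lemma Cexpi_pow t n : (Cexpi t ^ n)%X = Cexpi (INR n * t).
Proof.
  induction n as [|n IH].
  - simpl Cpow. simpl INR. rewrite Rmult_0_l, Cexpi_0. reflexivity.
  - simpl Cpow. rewrite IH, <- Cexpi_add, S_INR. f_equal. ring.
Qed.

Lemma Cpow_mul z w n : ((z * w) ^ n)%X = (z ^ n * w ^ n)%X.
Proof. induction n as [|n IH]; simpl; [ring | rewrite IH; ring]. Qed.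

(** Replacing the second map by [h v = f A2 (v / f)] and [g v = B2 (v / f) / f], with
    [f = e^(i gam)], normalises the sum of the derivatives to [1 / quad c]. The convolution at [z]
    is then [F (e f z) / (2 e f)], so the real direction for [F] becomes the direction of
    [1 / (e f)], that is [- (phi + gam)]. *)
Lemma convolution_convex (I : R -> Prop) (k : R -> R) (V : Cx -> Cx)
    (c lam a theta phi gam : R) (n : nat) (A1 B1 A2 B2 : nat -> Cx) :
  open_interval I -> 0 < lam ->
  (forall w, I (fst w) -> inD (V w)) ->
  (forall w, I (fst w) -> cder V w (RtoC lam * quad c (V w))%X) ->
  (forall x, I x -> 0 < k x) ->
  (forall w, I (fst w) -> k (fst w) <= fst ((1 - V w * V w) / quad c (V w))%X) ->
  (forall v, inD v -> exists w, I (fst w) /\ V w = v) ->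
  (forall v, inD v -> quad c v <> 0%X) ->
  (0 < n)%nat -> -1 < a < 1 -> (1 - a) * INR n <= 2 * (1 + a) ->
  ps_on_D A1 -> ps_on_D B1 ->
  (forall z, inD z ->
     Cadd (Cps A1 z) (Cmul (Cexpi (- 2 * phi)) (Cps B1 z)) =
     Cdiv (Cmul (RtoC (1 + a)) z) (Csub Cone (Cmul (Cexpi phi) z))) ->
  dilatation_is A1 B1 (fun z =>
     Cmul (Cexpi (2 * phi))
       (Cdiv (Csub (RtoC a) (Cmul z (Cexpi phi)))
             (Csub Cone (Cmul (RtoC a) (Cmul z (Cexpi phi)))))) ->
  ps_on_D A2 -> ps_on_D B2 -> A2 O = 0%X -> B2 O = 0%X ->
  dilatation_is A2 B2 (fun z => Cmul (Cexpi theta) (Cpow z n)) ->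
  (forall z, inD z ->
     (Cps (dps A2) z + Cexpi (- 2 * gam) * Cps (dps B2) z)%X =
     (1 / quad c (Cexpi gam * z))%X) ->
  convex_in_direction (hfun (hconv A1 A2) (hconv B1 B2)) (- (phi + gam)).
Proof.
  intros HI Hlam HVD HV Hk HP Honto HQ Hn Ha Hbound HA1 HB1 Hsum1 Hdil1
    HA2 HB2 HA20 HB20 Hdil2 Hder2.
  set (e := Cexpi phi). set (f := Cexpi gam).
  assert (He : Cmod e = 1) by apply Cmod_Cexpi.
  assert (He0 : e <> 0%X) by apply Cexpi_neq_0.
  assert (Hf0 : f <> 0%X) by apply Cexpi_neq_0.
  assert (H20 : RtoC 2 <> 0%X) by (apply RtoC_neq_0; lra).
  assert (Emf : Cexpi (- gam) = Cinv f) by apply Cexpi_opp.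
  assert (Em2 : Cexpi (- 2 * gam) = Cinv (f * f)%X).
  { replace (- 2 * gam) with (- gam + - gam) by ring.
    rewrite Cexpi_add, Emf. field. exact Hf0. }
  assert (HD : forall v, inD v -> inD (Cinv f * v)%X).
  { intros v Hv. rewrite <- Emf. now apply inD_rot. }
  set (h := fun v => (f * Cps A2 (Cinv f * v))%X).
  set (g := fun v => (Cinv f * Cps B2 (Cinv f * v))%X).
  set (h1 := fun v => Cps (dps A2) (Cinv f * v)%X).
  set (g1 := fun v => (Cinv (f * f) * Cps (dps B2) (Cinv f * v))%X).
  assert (Hder : forall X v, ps_on_D X -> inD v ->
    cder (fun v => Cps X (Cinv f * v)%X) v (Cps (dps X) (Cinv f * v) * Cinv f)%X).
  { intros X v HX Hv.
    apply (cder_comp (fun v => Cinv f * v)%X (Cps X)); [|apply cder_Cps; auto].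
    eapply cder_eq; [apply cder_scal, cder_id | ring]. }
  (* The rotated dilatation is [f^(-2) e^(i theta) (v / f)^n], whence the new angle. *)
  destruct (shear_convex I k V c lam a (theta - 2 * gam - INR n * gam) n h g h1 g1
    HI Hlam HVD HV Hk HP Honto HQ) as [Hinj Hconv]; try assumption.
  { intros v Hv. eapply cder_eq; [apply cder_scal; now apply Hder|].
    unfold h1. field. exact Hf0. }
  { intros v Hv. eapply cder_eq; [apply cder_scal; now apply Hder|].
    unfold g1. field. exact Hf0. }
  { intros v Hv. unfold h1, g1. rewrite <- Em2, Hder2 by auto. fold f.
    replace (f * (Cinv f * v))%X with v by (field; exact Hf0). reflexivity. }
  { intros v Hv. unfold h1, g1.
    rewrite (dilatation_dps A2 B2 _ _ HA2 HB2 Hdil2 (HD v Hv)).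
    rewrite Cpow_mul, <- Emf, Cexpi_pow.
    replace (theta - 2 * gam - INR n * gam)
      with (- 2 * gam + (theta + INR n * - gam)) by ring.
    rewrite !Cexpi_add, Em2. ring. }
  set (F := fun v => ((RtoC (1 + a) * h v + RtoC (1 - a) * (v * h1 v)) +
              Cconj (RtoC (1 + a) * g v - RtoC (1 - a) * (v * g1 v)))%X).
  change (forall v1 v2, inD v1 -> inD v2 -> F v1 = F v2 -> v1 = v2) in Hinj.
  change (forall v1 v2 u, inD v1 -> inD v2 -> snd (F v1) = snd (F v2) ->
     fst (F v1) <= u <= fst (F v2) -> exists v, inD v /\ F v = (u, snd (F v1))) in Hconv.
  pose proof (half_plane_map_coefs a phi A1 B1 Ha HA1 HB1 Hsum1 Hdil1) as Hcoef.
  assert (EF : forall z, inD z ->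
    hfun (hconv A1 A2) (hconv B1 B2) z =
      (Cinv (RtoC 2 * e * f) * F (e * f * z))%X).
  { intros z Hz. unfold hfun.
    rewrite (Cps_hconv_affine A1 A2 e (Cinv (RtoC 2 * e))%X (RtoC (1 - a)) (RtoC (1 + a)) z)
      by (try assumption; intros m; apply Hcoef).
    rewrite (Cps_hconv_affine B1 B2 e (e / RtoC 2)%X (- RtoC (1 - a))%X (RtoC (1 + a)) z)
      by (try assumption; intros m; destruct (Hcoef m) as [_ ->]; fold e; field; exact H20).
    unfold F, h, g, h1, g1.
    replace (Cinv f * (e * f * z))%X with (e * z)%X by (field; exact Hf0).
    set (b1 := Cps (dps B2) (e * z)%X). set (b0 := Cps B2 (e * z)%X).
    replace (e / RtoC 2 * (- RtoC (1 - a) * (e * z * b1) + RtoC (1 + a) * b0))%X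
      with (e / RtoC 2 * f * (RtoC (1 + a) * (Cinv f * b0)
              - RtoC (1 - a) * (e * f * z * (Cinv (f * f) * b1))))%X
      by (field; auto).
    set (Y := (RtoC (1 + a) * (Cinv f * b0)
              - RtoC (1 - a) * (e * f * z * (Cinv (f * f) * b1)))%X).
    rewrite (Cconj_mul (e / RtoC 2 * f)%X Y).
    (* [e] and [f] are unimodular, so conjugation inverts them and both parts share the factor
       [1 / (2 e f)]. *)
    replace (Cconj (e / RtoC 2 * f)%X) with (Cinv (RtoC 2 * e * f))%X.
    - field. auto.
    - replace (e / RtoC 2 * f)%X with (RtoC (/ 2) * (e * f))%X.
      + unfold e, f. rewrite <- Cexpi_add, Cconj_mul, Cconj_Cexpi, Cexpi_opp, Cexpi_add.
        fold e f. replace (Cconj (RtoC (/ 2))) with (Cinv (RtoC 2)).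
        * field. auto.
        * apply Cx_ext; simpl; field.
      + replace (RtoC (/ 2)) with (Cinv (RtoC 2)) by (apply Cx_ext; simpl; field).
        field. exact H20. }
  assert (Erot : forall z, inD z -> inD (e * f * z)%X).
  { intros z Hz. unfold e, f. rewrite <- Cexpi_add. now apply inD_rot. }
  assert (Hmul : forall x y, (Cinv (RtoC 2 * e * f) * x = Cinv (RtoC 2 * e * f) * y)%X -> x = y).
  { intros x y E.
    replace x with (RtoC 2 * e * f * (Cinv (RtoC 2 * e * f) * x))%X by (field; auto).
    rewrite E. field. auto. }
  assert (Edir : Cexpi (- (phi + gam)) = Cinv (e * f)%X).
  { rewrite Cexpi_opp, Cexpi_add. reflexivity. }
  split.
  - intros z w Hz Hw E. rewrite !EF in E by assumption.
    apply Hmul, Hinj in E; auto.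
    replace z with (Cinv (e * f) * (e * f * z))%X by (field; auto).
    rewrite E. field. auto.
  - intros w1 t [z1 [Hz1 <-]] [z2 [Hz2 E]] s Hs. rewrite Edir in *.
    rewrite !EF in E by assumption. rewrite EF by assumption.
    (* A displacement [t] along [1 / (e f)] is a real displacement [2 t] for [F]; when [t < 0] the
       endpoints exchange roles. *)
    assert (E2 : F (e * f * z2)%X = (F (e * f * z1) + RtoC 2 * RtoC t)%X).
    { apply Hmul. rewrite E. field. auto. }
    rewrite <- RtoC_mul in E2.
    assert (Efst : fst (F (e * f * z2)%X) = fst (F (e * f * z1)%X) + 2 * t)
      by (rewrite E2; reflexivity).
    assert (Esnd : snd (F (e * f * z2)%X) = snd (F (e * f * z1)%X))
      by (rewrite E2; simpl; ring).
    assert (Hv : exists v, inD v /\ F v =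
      (fst (F (e * f * z1)%X) + 2 * (s * t), snd (F (e * f * z1)%X))).
    { destruct (Rle_lt_dec 0 t) as [Ht|Ht].
      - apply (Hconv (e * f * z1)%X (e * f * z2)%X); auto. rewrite Efst. nra.
      - rewrite <- Esnd. apply (Hconv (e * f * z2)%X (e * f * z1)%X); auto.
        rewrite Efst. nra. }
    destruct Hv as [v [Hv Ev]].
    assert (HvD : inD (Cinv (e * f) * v)%X) by (rewrite <- Edir; now apply inD_rot).
    exists (Cinv (e * f) * v)%X. split; [exact HvD|].
    rewrite EF by exact HvD.
    replace (e * f * (Cinv (e * f) * v))%X with v by (field; auto).
    replace (F v) with (F (e * f * z1) + RtoC 2 * RtoC (s * t))%X.
    + field. auto.
    + rewrite Ev, <- RtoC_mul. apply Cx_ext; simpl; ring.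
Qed.

(** * The complex exponential *)

Definition Cexp (z : Cx) : Cx := (exp (fst z) * cos (snd z), exp (fst z) * sin (snd z)).

Lemma Cexp_add z w : Cexp (z + w)%X = (Cexp z * Cexp w)%X.
Proof.
  unfold Cexp; simpl. rewrite exp_plus, cos_plus, sin_plus.
  apply Cx_ext; simpl; ring.
Qed.

Lemma Cexp_0 : Cexp 0%X = 1%X.
Proof. unfold Cexp; simpl. rewrite exp_0, cos_0, sin_0. apply Cx_ext; simpl; ring. Qed.

Lemma derivable_pt_lim_0_remainder f l :
  derivable_pt_lim f 0 l -> forall eps, 0 < eps -> exists d, 0 < d /\ forall x,
    Rabs x < d -> Rabs (f x - f 0 - l * x) <= eps * Rabs x.
Proof.
  intros H eps Heps. destruct (H eps Heps) as [[d Hd] Hx]. simpl in Hx.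
  exists d. split; [exact Hd|]. intros x Hxd.
  destruct (Req_dec x 0) as [->|Hne].
  - replace (f 0 - f 0 - l * 0) with 0 by ring. rewrite Rabs_R0. lra.
  - specialize (Hx x Hne Hxd). rewrite Rplus_0_l in Hx.
    replace (f x - f 0 - l * x) with (((f x - f 0) / x - l) * x) by (field; exact Hne).
    rewrite Rabs_mult. apply Rmult_le_compat_r; [apply Rabs_pos | lra].
Qed.

Lemma cder_Cexp_0 : cder Cexp 0%X 1%X.
Proof.
  intros eps Heps.
  (* The four error terms add up to [(3 + 1 + 3 + 2) * e * D]; the bound [e <= 1] gives
     [exp x <= 3]. *)
  set (e := Rmin (eps / 10) 1).
  assert (He : 0 < e) by (apply Rmin_pos; lra).
  assert (He1 : e <= eps / 10) by apply Rmin_l.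
  assert (He2 : e <= 1) by apply Rmin_r.
  destruct (derivable_pt_lim_0_remainder exp 1) with (eps := e) as [d1 [Hd1 Hexp]];
    [rewrite <- exp_0; apply derivable_pt_lim_exp | exact He |].
  destruct (derivable_pt_lim_0_remainder sin 1) with (eps := e) as [d2 [Hd2 Hsin]];
    [rewrite <- cos_0; apply derivable_pt_lim_sin | exact He |].
  destruct (derivable_pt_lim_0_remainder cos (- sin 0)) with (eps := e)
    as [d3 [Hd3 Hcos]]; [apply derivable_pt_lim_cos | exact He |].
  exists (Rmin (Rmin d1 d2) (Rmin d3 e)).
  split; [repeat (assumption || apply Rmin_pos)|].
  intros w Hw. split_Rmin.
  replace (w - 0)%X with w in * by ring.
  replace (Cexp w - Cexp 0 - 1 * w)%X with (Cexp w - 1 - w)%X by (rewrite Cexp_0; ring).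
  destruct w as [x y]. set (D := Cmod (x, y)) in *.
  pose proof (Cmod_fst (x, y)) as HxD. pose proof (Cmod_snd (x, y)) as HyD.
  fold D in HxD, HyD. simpl in HxD, HyD.
  specialize (Hexp x ltac:(lra)). specialize (Hsin y ltac:(lra)).
  specialize (Hcos y ltac:(lra)).
  rewrite exp_0 in Hexp. rewrite sin_0 in Hsin, Hcos. rewrite cos_0 in Hcos.
  replace (exp x - 1 - 1 * x) with (exp x - 1 - x) in Hexp by ring.
  replace (sin y - 0 - 1 * y) with (sin y - y) in Hsin by ring.
  replace (cos y - 1 - - 0 * y) with (cos y - 1) in Hcos by ring.
  pose proof (Rabs_pos x) as Hx0. pose proof (Rabs_pos y) as Hy0.
  assert (HD : 0 <= D) by apply Cmod_ge_0.
  assert (Hexp1 : Rabs (exp x - 1) <= 2 * e).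
  { replace (exp x - 1) with ((exp x - 1 - x) + x) by ring.
    eapply Rle_trans; [apply Rabs_triang|]. nra. }
  assert (Hexp3 : Rabs (exp x) <= 3).
  { replace (exp x) with ((exp x - 1) + 1) by ring.
    eapply Rle_trans; [apply Rabs_triang|]. rewrite Rabs_R1. lra. }
  eapply Rle_trans; [apply Cmod_le_abs|]. simpl.
  replace (exp x * cos y + - (1) + - x)
    with (exp x * (cos y - 1) + (exp x - 1 - x)) by ring.
  replace (exp x * sin y + - 0 + - y)
    with (exp x * (sin y - y) + (exp x - 1) * y) by ring.
  assert (HeyD : e * Rabs y <= e * D) by (apply Rmult_le_compat_l; lra).
  assert (HexD : e * Rabs x <= e * D) by (apply Rmult_le_compat_l; lra).
  assert (B1 : Rabs (exp x * (cos y - 1)) <= 3 * (e * D)).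
  { rewrite Rabs_mult. apply Rmult_le_compat; try apply Rabs_pos; lra. }
  assert (B2 : Rabs (exp x * (sin y - y)) <= 3 * (e * D)).
  { rewrite Rabs_mult. apply Rmult_le_compat; try apply Rabs_pos; lra. }
  assert (B3 : Rabs ((exp x - 1) * y) <= 2 * e * D).
  { rewrite Rabs_mult. apply Rmult_le_compat; try apply Rabs_pos; lra. }
  pose proof (Rabs_triang (exp x * (cos y - 1)) (exp x - 1 - x)).
  pose proof (Rabs_triang (exp x * (sin y - y)) ((exp x - 1) * y)).
  assert (10 * e * D <= eps * D) by (apply Rmult_le_compat_r; lra).
  pose proof (Rmult_le_pos e D ltac:(lra) HD). lra.
Qed.

(** The functional equation carries the derivative from 0 to any point. *)
Lemma cder_Cexp z : cder Cexp z (Cexp z).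
Proof.
  intros eps Heps. pose proof (Cmod_ge_0 (Cexp z)) as Hm.
  destruct (cder_Cexp_0 (eps / (Cmod (Cexp z) + 1))) as [d [Hd H]].
  { apply Rdiv_lt_0_compat; lra. }
  exists d. split; [exact Hd|]. intros w Hw.
  specialize (H (w - z)%X). replace (w - z - 0)%X with (w - z)%X in H by ring.
  specialize (H Hw). rewrite Cexp_0 in H.
  replace (Cexp w) with (Cexp z * Cexp (w - z))%X
    by (rewrite <- Cexp_add; f_equal; ring).
  replace (Cexp z * Cexp (w - z) - Cexp z - Cexp z * (w - z))%X
    with (Cexp z * (Cexp (w - z) - 1 - 1 * (w - z)))%X by ring.
  rewrite Cmod_mul.
  assert (E : eps = (Cmod (Cexp z) + 1) * (eps / (Cmod (Cexp z) + 1))) by (field; lra).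
  set (q := eps / (Cmod (Cexp z) + 1)) in *.
  pose proof (Cmod_ge_0 (Cexp (w - z) - 1 - 1 * (w - z))%X).
  rewrite E. rewrite Rmult_assoc. apply Rmult_le_compat; lra.
Qed.

Lemma cos_Carg_pos x y s :
  0 < x -> s = sqrt (x ^ 2 + y ^ 2) ->
  s * cos (atan (y / x)) = x /\ s * sin (atan (y / x)) = y.
Proof.
  intros Hx ->. rewrite cos_atan, sin_atan.
  assert (E : sqrt (x ^ 2 + y ^ 2) = x * sqrt (1 + (y / x)²)).
  { replace (x ^ 2 + y ^ 2) with (x ^ 2 * (1 + (y / x)²))
      by (unfold Rsqr; field; lra).
    rewrite sqrt_mult_alt by nra. rewrite sqrt_pow2 by lra. reflexivity. }
  assert (0 < sqrt (1 + (y / x)²)).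
  { apply sqrt_lt_R0. pose proof (Rle_0_sqr (y / x)). lra. }
  rewrite E. split; field; lra.
Qed.

Lemma Cmod_Cexpi_Carg z : z <> 0%X ->
  (RtoC (Cmod z) * Cexpi (Carg z))%X = z.
Proof.
  destruct z as [x y]. intros Hz.
  assert (G : Cmod (x, y) * cos (Carg (x, y)) = x /\ Cmod (x, y) * sin (Carg (x, y)) = y).
  2:{ destruct G as [G1 G2]. apply Cx_ext; simpl; lra. }
  unfold Carg. simpl.
  destruct (Rlt_dec 0 x) as [Hx|Hx]; [now apply cos_Carg_pos|].
  destruct (Rlt_dec x 0) as [Hx'|Hx'].
  (* The opposite point has the same ratio [y / x], and a shift of the angle by [PI] or [- PI]
     restores the signs. *)
  - destruct (cos_Carg_pos (- x) (- y) (Cmod (x, y))) as [G1 G2]; [lra| |].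
    { unfold Cmod. simpl. f_equal. ring. }
    replace (- y / - x) with (y / x) in G1, G2 by (field; lra).
    destruct (Rle_dec 0 y).
    + rewrite neg_cos, neg_sin. lra.
    + replace (atan (y / x) - PI) with (- (PI - atan (y / x))) by ring.
      rewrite cos_neg, sin_neg, Rtrigo_facts.cos_pi_minus, Rtrigo_facts.sin_pi_minus. lra.
  - assert (x = 0) as -> by lra.
    assert (E : Cmod (0, y) = Rabs y).
    { unfold Cmod. simpl fst. simpl snd. replace (0 ^ 2 + y ^ 2) with (y²)
        by (unfold Rsqr; ring). apply sqrt_Rsqr_abs. }
    rewrite E.
    destruct (Rlt_dec 0 y) as [Hy|Hy].
    + rewrite cos_PI2, sin_PI2, Rabs_pos_eq; lra.
    + destruct (Rlt_dec y 0) as [Hy'|Hy'].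
      * rewrite cos_neg, sin_neg, cos_PI2, sin_PI2, Rabs_left; lra.
      * exfalso. apply Hz. apply Cx_ext; simpl; lra.
Qed.

Lemma Cexp_Clog z : z <> 0%X -> Cexp (Clog z) = z.
Proof.
  intros Hz. rewrite <- (Cmod_Cexpi_Carg z Hz) at 2.
  unfold Cexp, Clog. simpl fst. simpl snd. rewrite exp_ln by now apply Cmod_pos.
  apply Cx_ext; simpl; ring.
Qed.

(** * Half-plane coordinates *)

(** The line [Re w = -1/2] is the perpendicular bisector of 0 and -1. *)
Lemma half_plane_Cmod_lt w : - (1 / 2) < fst w <-> Cmod w < Cmod (1 + w)%X.
Proof.
  split.
  - intros H. apply Cmod_lt_sq. simpl. nra.
  - intros H. apply Cmod_lt_sq_inv in H. simpl in H. nra.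
Qed.

Lemma open_interval_above lo : open_interval (fun x => lo < x).
Proof.
  split.
  - intros x Hx. exists (x - lo). split; [lra|]. intros t Ht.
    apply Rabs_def2 in Ht. lra.
  - intros x y t Hx Hy Ht. lra.
Qed.

Lemma open_interval_between lo hi : open_interval (fun x => lo < x < hi).
Proof.
  split.
  - intros x Hx. exists (Rmin (x - lo) (hi - x)). split; [apply Rmin_pos; lra|].
    intros t Ht. split_Rmin. apply Rabs_def2 in H. apply Rabs_def2 in H0. lra.
  - intros x y t Hx Hy Ht. lra.
Qed.

(** [V] inverts [v / (1 - v)]. In this coordinate [(1 - v^2) / quad (-1) v = (1 + v) / (1 - v) = 1 +
    2 w], so [k] is exactly its real part. *)
Lemma half_plane_coordinates :
  let I := fun x => - (1 / 2) < x in
  let V := fun w => (w / (1 + w))%X in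
  let k := fun x => 1 + 2 * x in
  open_interval I /\
  (forall w, I (fst w) -> inD (V w)) /\
  (forall w, I (fst w) -> cder V w (RtoC 1 * quad (-1) (V w))%X) /\
  (forall x, I x -> 0 < k x) /\
  (forall w, I (fst w) -> k (fst w) <= fst ((1 - V w * V w) / quad (-1) (V w))%X) /\
  (forall v, inD v -> exists w, I (fst w) /\ V w = v) /\
  (forall v, inD v -> quad (-1) v <> 0%X).
Proof.
  intros I V k.
  assert (Hne : forall w, I (fst w) -> (1 + w)%X <> 0%X).
  { intros w Hw E. apply (f_equal fst) in E. simpl in E. unfold I in Hw. lra. }
  assert (Equad : forall v, quad (-1) v = ((1 - v) * (1 - v))%X).
  { intros v. unfold quad. replace (2 * -1) with (-2) by ring. ring. }
  assert (H1v : forall v, inD v -> (1 - v)%X <> 0%X).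
  { intros v Hv. replace v with (1 * v)%X by ring.
    apply inD_sub_neq_0; [exact Hv | apply Cmod_one]. }
  assert (HVD : forall w, I (fst w) -> inD (V w)).
  { intros w Hw. unfold inD, V. rewrite Cmod_Cdiv by now apply Hne.
    apply half_plane_Cmod_lt in Hw. pose proof (Cmod_ge_0 w).
    apply Rmult_lt_reg_r with (Cmod (1 + w)%X); [lra|].
    unfold Rdiv. rewrite Rmult_assoc, Rinv_l; lra. }
  split; [apply open_interval_above|]. split; [exact HVD|]. split; [|split; [|split; [|split]]].
  - intros w Hw. eapply cder_eq.
    + apply (cder_div (fun w => w) (fun w => 1 + w)%X); [apply cder_id| |now apply Hne].
      apply cder_add; [apply cder_const | apply cder_id].
    + rewrite Equad. unfold V. change (RtoC 1) with 1%X. simpl. field. now apply Hne.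
  - intros x Hx. unfold I, k in *. lra.
  - intros w Hw. right. rewrite Equad.
    replace ((1 - V w * V w) / ((1 - V w) * (1 - V w)))%X with (1 + RtoC 2 * w)%X.
    + simpl. unfold k. ring.
    + pose proof (H1v _ (HVD w Hw)) as H2. unfold V in *. field.
      split; [now apply Hne|]. change (RtoC 1) with 1%X.
      replace (1 + w - w)%X with 1%X by ring.
      apply Cmod_pos_neq. rewrite Cmod_one. lra.
  - intros v Hv. exists (v / (1 - v))%X. pose proof (H1v v Hv) as H2.
    assert (H3 : (1 - v + v)%X <> 0%X).
    { replace (1 - v + v)%X with 1%X by ring. apply Cmod_pos_neq. rewrite Cmod_one. lra. }
    split.
    + apply half_plane_Cmod_lt.
      replace (1 + v / (1 - v))%X with (1 / (1 - v))%X by (field; exact H2).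
      rewrite !Cmod_Cdiv, Cmod_one by exact H2. pose proof (Cmod_pos _ H2).
      apply Rmult_lt_compat_r; [now apply Rinv_0_lt_compat | exact Hv].
    + unfold V. field. auto.
  - intros v Hv E. rewrite Equad in E.
    apply (H1v v Hv), (Cmul_integral _ _ E), (H1v v Hv).
Qed.

(** * Strip coordinates *)

Lemma Cexpi_sub_opp b : (Cexpi b - Cinv (Cexpi b))%X = (RtoC (2 * sin b) * Ci)%X.
Proof.
  rewrite <- Cexpi_opp. unfold Cexpi. rewrite cos_neg, sin_neg.
  apply Cx_ext; simpl; ring.
Qed.

Lemma quad_cos b v : quad (cos b) v = ((1 + Cexpi b * v) * (1 + Cinv (Cexpi b) * v))%X.
Proof.
  unfold quad.
  replace (RtoC (2 * cos b)) with (Cexpi b + Cinv (Cexpi b))%X.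
  - pose proof (Cexpi_neq_0 b). field. assumption.
  - rewrite <- Cexpi_opp. unfold Cexpi. rewrite cos_neg, sin_neg.
    apply Cx_ext; simpl; ring.
Qed.

Lemma Ci_mul_Ci : (Ci * Ci)%X = (- (1))%X.
Proof. apply Cx_ext; simpl; ring. Qed.

Lemma Ci_neq_0 : Ci <> 0%X.
Proof. intros E. apply (f_equal snd) in E. simpl in E. lra. Qed.

(** Up to a unimodular factor, [1 - N e^(-ib)] is [e^(ib) - N]. The real axis is the perpendicular
    bisector of [e^(ib)] and [e^(-ib)], and [0 < sin b] puts the latter below it. *)
Lemma lower_half_plane_Cmod_lt b N :
  0 < sin b ->
  snd N < 0 <->
  Cmod (N - Cinv (Cexpi b))%X < Cmod (1 - N * Cinv (Cexpi b))%X.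
Proof.
  intros Hb. rewrite <- Cexpi_opp. unfold Cexpi. rewrite cos_neg, sin_neg.
  pose proof (sin2_cos2 b) as Hsc. unfold Rsqr in Hsc.
  destruct N as [p q].
  set (s := sin b) in *. set (t := cos b) in *.
  assert (E : (p + - t) ^ 2 + (q + - - s) ^ 2 + - 4 * (q * s) =
    (1 + - (p * t - q * - s)) ^ 2 + (0 + - (p * - s + q * t)) ^ 2).
  { replace ((1 + - (p * t - q * - s)) ^ 2 + (0 + - (p * - s + q * t)) ^ 2)
      with (1 - 2 * (p * t + q * s) + (p ^ 2 + q ^ 2) * (s * s + t * t)) by ring.
    replace ((p + - t) ^ 2 + (q + - - s) ^ 2)
      with (p ^ 2 + q ^ 2 - 2 * p * t + 2 * q * s + (s * s + t * t)) by ring.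
    rewrite Hsc. ring. }
  split.
  - intros Hq. apply Cmod_lt_sq. simpl in *. rewrite <- E. nra.
  - intros H. apply Cmod_lt_sq_inv in H. simpl in *. rewrite <- E in H. nra.
Qed.

(** On the lower half-plane [- acos (p / r)] is an argument in [(- PI, 0)], without case
    distinction; it serves as [Re w], and [Im w] is minus the logarithm of the modulus. *)
Lemma Cexp_polar_lower N :
  snd N < 0 -> exists w, - PI < fst w < 0 /\ Cexp (Ci * w)%X = N.
Proof.
  destruct N as [p q]. simpl. intros Hq.
  set (r := Cmod (p, q)).
  assert (Hr : 0 < r).
  { apply Cmod_pos. intros E. apply (f_equal snd) in E. simpl in E. lra. }
  assert (Hr2 : r * r = p * p + q * q).
  { pose proof (Cmod_sq (p, q)) as E. fold r in E. simpl in E. lra. }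
  set (t := p / r).
  assert (Ht : t * r = p) by (unfold t; field; lra).
  assert (Hq2 : 1 - t² = (- q / r)²).
  { unfold Rsqr, t. apply Rmult_eq_reg_r with (r * r); [|nra].
    field_simplify; [|lra|lra]. nra. }
  assert (Hqr : 0 < - q / r) by (apply Rdiv_lt_0_compat; lra).
  assert (Ht1 : -1 <= t <= 1) by (unfold Rsqr in Hq2; nra).
  assert (Hsin : sin (acos t) = - q / r).
  { rewrite sin_acos, Hq2 by exact Ht1. apply sqrt_Rsqr. lra. }
  exists (- acos t, - ln r). split; simpl.
  - pose proof (acos_bound t) as [H0 HPI]. split.
    + apply Ropp_lt_contravar. destruct HPI as [H|H]; [exact H|].
      rewrite H, sin_PI in Hsin. lra.
    + apply Ropp_lt_gt_0_contravar. destruct H0 as [H|H]; [exact H|].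
      rewrite <- H, sin_0 in Hsin. lra.
  - unfold Cexp; simpl.
    replace (0 * - acos t - 1 * - ln r) with (ln r) by ring.
    replace (0 * - ln r + 1 * - acos t) with (- acos t) by ring.
    rewrite exp_ln, cos_neg, sin_neg, cos_acos, Hsin by assumption.
    apply Cx_ext; simpl; [lra | field; lra].
Qed.

(** The coordinate [w] is [2 sin b] times the logarithmic strip map, minus [b]: this moves the strip
    to [- PI < Re w < 0] and explains the factor [/ (2 * sin b)]. [Cexp (Ci * w)] takes it to the
    lower half-plane, and a Möbius map takes that to the disk. In this coordinate [(1 - v^2) / quad
    (cos b) v = - sin w / sin b], with real part [- sin x cosh y / sin b]; [k] comes from
    [cosh y >= 1]. *)
Lemma strip_coordinates b :
  0 < b < PI ->
  let I := fun x => - PI < x < 0 in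
  let f := Cinv (Cexpi b) in
  let V := fun w => ((Cexp (Ci * w) - f) / (1 - Cexp (Ci * w) * f))%X in
  let k := fun x => - sin x / sin b in
  open_interval I /\
  0 < / (2 * sin b) /\
  (forall w, I (fst w) -> inD (V w)) /\
  (forall w, I (fst w) -> cder V w (RtoC (/ (2 * sin b)) * quad (cos b) (V w))%X) /\
  (forall x, I x -> 0 < k x) /\
  (forall w, I (fst w) -> k (fst w) <= fst ((1 - V w * V w) / quad (cos b) (V w))%X) /\
  (forall v, inD v -> exists w, I (fst w) /\ V w = v) /\
  (forall v, inD v -> quad (cos b) v <> 0%X).
Proof.
  intros Hb I f V k.
  assert (Hsb : 0 < sin b) by (apply sin_gt_0; lra).
  set (e := Cexpi b) in *.
  assert (He : Cmod e = 1) by apply Cmod_Cexpi.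
  assert (He0 : e <> 0%X) by apply Cexpi_neq_0.
  assert (Hf : Cmod f = 1) by (unfold f; rewrite Cmod_Cinv, He by exact He0; field).
  assert (Hef : (e - f)%X = (RtoC (2 * sin b) * Ci)%X) by apply Cexpi_sub_opp.
  assert (HS : RtoC (2 * sin b) <> 0%X) by (apply RtoC_neq_0; lra).
  pose proof Ci_neq_0 as HCi.
  assert (Hef0 : (e - f)%X <> 0%X).
  { rewrite Hef. intros E. exact (HCi (Cmul_integral _ _ E HS)). }
  assert (Hee : (e * e - 1)%X <> 0%X).
  { intros E. apply Hef0. replace (e - f)%X with ((e * e - 1) / e)%X
      by (unfold f; field; exact He0).
    rewrite E. field. exact He0. }
  assert (HN : forall w, I (fst w) -> snd (Cexp (Ci * w)%X) < 0).
  { intros w Hw. unfold Cexp; simpl.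
    replace (0 * snd w + 1 * fst w) with (fst w) by ring.
    pose proof (exp_pos (0 * fst w - 1 * snd w)).
    assert (sin (fst w) < 0) by (apply sin_lt_0_var; unfold I in Hw; lra). nra. }
  assert (Hlt : forall N, snd N < 0 -> Cmod (N - f)%X < Cmod (1 - N * f)%X)
    by (intros N; apply lower_half_plane_Cmod_lt; exact Hsb).
  assert (Hden : forall N, snd N < 0 -> (1 - N * f)%X <> 0%X).
  { intros N H. apply Cmod_pos_neq. pose proof (Hlt N H).
    pose proof (Cmod_ge_0 (N - f)%X). lra. }
  assert (Hden' : forall N, snd N < 0 -> (e - N)%X <> 0%X).
  { intros N H E. apply (Hden N H).
    replace (1 - N * f)%X with ((e - N) / e)%X by (unfold f; field; exact He0).
    rewrite E. field. exact He0. }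
  assert (HVD : forall w, I (fst w) -> inD (V w)).
  { intros w Hw. pose proof (HN w Hw) as H. unfold inD, V.
    rewrite Cmod_Cdiv by now apply Hden.
    pose proof (Cmod_pos _ (Hden _ H)). pose proof (Hlt _ H).
    apply Rmult_lt_reg_r with (Cmod (1 - Cexp (Ci * w) * f)%X); [assumption|].
    unfold Rdiv. rewrite Rmult_assoc, Rinv_l; lra. }
  (* Expressing the scale through [e] and [f] reduces the identities below to rational ones. *)
  assert (Hinv : RtoC (/ (2 * sin b)) = (Ci / (e - f))%X).
  { rewrite Hef. replace (RtoC (/ (2 * sin b))) with (Cinv (RtoC (2 * sin b))).
    - field. auto.
    - apply Cx_ext; simpl; field; lra. }
  split; [apply open_interval_between|].
  split; [apply Rinv_0_lt_compat; lra|].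
  split; [exact HVD|]. split; [|split; [|split; [|split]]].
  - intros w Hw. pose proof (HN w Hw) as H.
    pose proof (Hden _ H) as H1. pose proof (Hden' _ H) as H2.
    assert (HE : cder (fun w => Cexp (Ci * w)%X) w (Cexp (Ci * w) * Ci)%X).
    { apply (cder_comp (fun w => Ci * w)%X Cexp); [|apply cder_Cexp].
      eapply cder_eq; [apply cder_scal, cder_id | ring]. }
    eapply cder_eq.
    + apply (cder_div (fun w => Cexp (Ci * w) - f)%X (fun w => 1 - Cexp (Ci * w) * f)%X).
      * apply cder_sub; [exact HE | apply cder_const].
      * apply cder_sub; [apply cder_const|].
        apply (cder_mul _ (fun _ => f)); [exact HE | apply cder_const].
      * exact H1.
    + rewrite quad_cos, Hinv. fold e f. unfold V. simpl.
      set (N := Cexp (Ci * w)%X) in *. unfold f in *. field. auto.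
  - intros x Hx. unfold I, k in *. apply Rdiv_lt_0_compat; [|exact Hsb].
    assert (sin x < 0) by (apply sin_lt_0_var; lra). lra.
  - intros w Hw. pose proof (HN w Hw) as H.
    pose proof (Hden _ H) as H1. pose proof (Hden' _ H) as H2.
    assert (HNm : (Cexp (- (Ci * w)) * Cexp (Ci * w))%X = 1%X).
    { rewrite <- Cexp_add. replace (- (Ci * w) + Ci * w)%X with 0%X by ring. apply Cexp_0. }
    assert (HN0 : Cexp (Ci * w)%X <> 0%X).
    { intros E. rewrite E in H. simpl in H. lra. }
    replace ((1 - V w * V w) / quad (cos b) (V w))%X
      with (RtoC (/ (2 * sin b)) * (- Ci * (Cexp (- (Ci * w)) - Cexp (Ci * w))))%X.
    + rewrite fst_RtoC_mul. unfold k. destruct w as [x y]. unfold Cexp. simpl.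
      replace (- (0 * y + 1 * x)) with (- x) by ring.
      replace (0 * y + 1 * x) with x by ring.
      replace (- (0 * x - 1 * y)) with y by ring.
      replace (0 * x - 1 * y) with (- y) by ring.
      rewrite sin_neg.
      assert (Hs : sin x < 0) by (apply sin_lt_0_var; unfold I in Hw; simpl in Hw; lra).
      assert (Hcosh : 2 <= exp y + exp (- y)).
      { assert (exp y * exp (- y) = 1) by (rewrite <- exp_plus, Rplus_opp_r; apply exp_0).
        pose proof (exp_pos y). pose proof (exp_pos (- y)).
        pose proof (Rle_0_sqr (exp y - exp (- y))) as Hsq. unfold Rsqr in Hsq. nra. }
      match goal with |- _ <= _ * ?X =>
        replace X with (- sin x * (exp y + exp (- y))) by ring end.
      replace (- sin x / sin b) with (/ (2 * sin b) * (- sin x * 2)) by (field; lra).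
      apply Rmult_le_compat_l; [left; apply Rinv_0_lt_compat; lra|].
      apply Rmult_le_compat_l; lra.
    + rewrite quad_cos, Hinv. fold e f. unfold V.
      replace (Cexp (- (Ci * w))%X) with (Cinv (Cexp (Ci * w))%X).
      2:{ replace (Cexp (- (Ci * w))%X)
            with (Cexp (- (Ci * w)) * Cexp (Ci * w) / Cexp (Ci * w))%X by (field; exact HN0).
          rewrite HNm. field. exact HN0. }
      set (N := Cexp (Ci * w)%X) in *.
      replace (Ci / (e - f) * (- Ci * (Cinv N - N)))%X
        with (- (Ci * Ci) * ((Cinv N - N) / (e - f)))%X by (field; auto).
      rewrite Ci_mul_Ci. unfold f in *. field.
      repeat split; auto; intros E; apply Hee.
      * rewrite <- E. ring.
      * apply (Cmul_integral (Cexp (Ci * w))%X); [|exact HN0].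
        fold N. rewrite <- E. ring.
  - intros v Hv. pose proof (inD_add_neq_0 v f Hv Hf) as H1.
    (* Inverse of the Möbius map; a point of the disk comes from the lower half-plane because
       [N - f = v (1 - N f)] with [Cmod v < 1]. *)
    set (N := ((v + f) / (1 + f * v))%X).
    assert (E1 : (1 - N * f)%X = ((1 - f * f) / (1 + f * v))%X)
      by (unfold N; field; exact H1).
    assert (E2 : (N - f)%X = (v * (1 - N * f))%X).
    { rewrite E1. unfold N. field. exact H1. }
    assert (H3 : (1 - N * f)%X <> 0%X).
    { rewrite E1. intros E. apply Hee.
      replace (e * e - 1)%X with ((1 - f * f) / (1 + f * v) * (1 + f * v) * (e * e))%X.
      - rewrite E. ring.
      - unfold f in *. field. split; [exact He0|].
        intros E'. apply H1. replace (1 + Cinv e * v)%X with ((e + v) / e)%X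
          by (field; exact He0). rewrite E'. field. exact He0. }
    assert (HsN : snd N < 0).
    { apply (lower_half_plane_Cmod_lt b N Hsb). fold e f. rewrite E2, Cmod_mul.
      pose proof (Cmod_pos _ H3). unfold inD in Hv. nra. }
    destruct (Cexp_polar_lower N HsN) as [w [Hw Ew]].
    exists w. split; [exact Hw|]. unfold V. rewrite Ew, E2. field. exact H3.
  - intros v Hv E. rewrite quad_cos in E. fold e f in E.
    apply (inD_add_neq_0 v f Hv Hf), (Cmul_integral _ _ E).
    now apply inD_add_neq_0.
Qed.

(** * Derivatives of the second map in the two cases *)

(** The logarithmic identity is exponentiated before it is differentiated, so that only a rational
    function has to be differentiated on the right. *)
Lemma strip_log_derivative b (A B : nat -> Cx) z :
  0 < b < PI -> ps_on_D A -> ps_on_D B -> inD z ->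
  (forall z, inD z ->
     Cadd (Cps A z) (Cps B z) =
     Cmul (Cinv (Cmul (RtoC (2 * sin b)) Ci))
          (Clog (Cdiv (Cadd Cone (Cmul z (Cexpi b)))
                      (Cadd Cone (Cmul z (Cexpi (- b))))))) ->
  (Cps (dps A) z + Cps (dps B) z)%X = (1 / quad (cos b) z)%X.
Proof.
  intros Hb HA HB Hz Hlog.
  assert (Hsb : 0 < sin b) by (apply sin_gt_0; lra).
  set (e := Cexpi b) in *. set (f := Cinv e).
  assert (He0 : e <> 0%X) by apply Cexpi_neq_0.
  assert (He1 : Cmod e = 1) by apply Cmod_Cexpi.
  assert (Hf1 : Cmod f = 1) by (unfold f; rewrite Cmod_Cinv, He1 by exact He0; field).
  assert (Hef : (e - f)%X = (RtoC (2 * sin b) * Ci)%X) by apply Cexpi_sub_opp.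
  assert (Hef0 : (e - f)%X <> 0%X).
  { rewrite Hef. intros E. apply Ci_neq_0, (Cmul_integral _ _ E), RtoC_neq_0. lra. }
  pose proof (fun w Hw => inD_add_neq_0 w e Hw He1) as H1.
  pose proof (fun w Hw => inD_add_neq_0 w f Hw Hf1) as H2.
  assert (Hexp : forall w, inD w ->
    Cexp ((e - f) * (Cps A w + Cps B w))%X = ((1 + e * w) / (1 + f * w))%X).
  { intros w Hw. rewrite Hlog, Cexpi_opp by exact Hw. fold e f. rewrite <- Hef.
    replace (w * e)%X with (e * w)%X by ring. replace (w * f)%X with (f * w)%X by ring.
    set (M := ((1 + e * w) / (1 + f * w))%X).
    replace ((e - f) * (Cinv (e - f) * Clog M))%X with (Clog M) by (field; exact Hef0).
    apply Cexp_Clog. intros E. apply (H1 w Hw).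
    replace (1 + e * w)%X with (M * (1 + f * w))%X by (unfold M; field; now apply H2).
    rewrite E. ring. }
  assert (E : ((1 + e * z) / (1 + f * z) * ((e - f) * (Cps (dps A) z + Cps (dps B) z)))%X =
    ((e - f) / ((1 + f * z) * (1 + f * z)))%X).
  { apply (cder_unique (fun w => (1 + e * w) / (1 + f * w))%X z).
    - apply (cder_ext_D (fun w => Cexp ((e - f) * (Cps A w + Cps B w))%X));
        [exact Hz | exact Hexp|].
      rewrite <- Hexp by exact Hz.
      apply (cder_comp (fun w => (e - f) * (Cps A w + Cps B w))%X Cexp); [|apply cder_Cexp].
      apply cder_scal, cder_add; now apply cder_Cps.
    - assert (Hlin : forall c, cder (fun w => 1 + c * w)%X z c).
      { intros c. eapply cder_eq.
        - apply cder_add; [apply cder_const | apply cder_scal, cder_id].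
        - ring. }
      eapply cder_eq; [apply cder_div; [apply Hlin | apply Hlin | now apply H2]|].
      simpl. field. now apply H2. }
  rewrite quad_cos. fold e f.
  pose proof (H1 z Hz) as H1z. pose proof (H2 z Hz) as H2z.
  replace (Cps (dps A) z + Cps (dps B) z)%X with
    ((1 + e * z) / (1 + f * z) * ((e - f) * (Cps (dps A) z + Cps (dps B) z))
      * ((1 + f * z) / ((1 + e * z) * (e - f))))%X by (field; auto).
  rewrite E. field. auto.
Qed.

Lemma half_plane_derivative gam (A B : nat -> Cx) z :
  ps_on_D A -> ps_on_D B -> inD z ->
  (forall z, inD z ->
     Cadd (Cps A z) (Cmul (Cexpi (- 2 * gam)) (Cps B z)) =
     Cdiv z (Csub Cone (Cmul (Cexpi gam) z))) ->
  (Cps (dps A) z + Cexpi (- 2 * gam) * Cps (dps B) z)%X =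
  (1 / quad (-1) (Cexpi gam * z))%X.
Proof.
  intros HA HB Hz Hsum.
  pose proof (inD_sub_neq_0 z _ Hz (Cmod_Cexpi gam)) as H1.
  apply (cder_unique (fun z => Cps A z + Cexpi (- 2 * gam) * Cps B z)%X z).
  - apply cder_add; [|apply cder_scal]; now apply cder_Cps.
  - apply (cder_ext_D (fun z => z / (1 - Cexpi gam * z))%X); [exact Hz| |].
    + intros w Hw. symmetry. now apply Hsum.
    + eapply cder_eq; [apply cder_div; [apply cder_id | apply cder_1_sub | exact H1]|].
      unfold quad. replace (2 * -1) with (-2) by ring.
      replace (1 + RtoC (-2) * (Cexpi gam * z) + Cexpi gam * z * (Cexpi gam * z))%X
        with ((1 - Cexpi gam * z) * (1 - Cexpi gam * z))%X by ring.
      simpl. field. exact H1.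
Qed.

Theorem theorem5 (a1 : Cx) (gam1 gam2 theta : R) (n : nat)
  (A1 B1 A2 B2 : nat -> Cx) :
  inD a1 ->
  0 <= gam1 < 2 * PI -> 0 <= gam2 < 2 * PI ->
  let a1' := Cmod (Cadd Cone a1) - 1 in
  let gama := Carg (Cadd Cone (Cconj a1)) in
  let phi := gam1 + gama in
  (* f1 = h1 + conj g1 in S(H^{a1}_{gam1}) *)
  class_S (Hhalf a1 gam1) A1 B1 ->
  (forall z, inD z ->
     Cadd (Cps A1 z) (Cmul (Cexpi (- 2 * phi)) (Cps B1 z)) =
     Cdiv (Cmul (RtoC (1 + a1')) z) (Csub Cone (Cmul (Cexpi phi) z))) ->
  dilatation_is A1 B1 (fun z =>
     Cmul (Cexpi (2 * phi))
       (Cdiv (Csub (RtoC a1') (Cmul z (Cexpi phi)))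
             (Csub Cone (Cmul (RtoC a1') (Cmul z (Cexpi phi)))))) ->
  (* f2 = h2 + conj g2 locally univalent with dilatation e^{i theta} z^n *)
  (0 < n)%nat ->
  harmonic_D A2 B2 ->
  locally_univalent_D (hfun A2 B2) ->
  dilatation_is A2 B2 (fun z => Cmul (Cexpi theta) (Cpow z n)) ->
  2 * INR n / (INR n + 2) <= Cmod (Cadd Cone a1) < 2 ->
  ( (* (1) *)
    (class_S (Hhalf Czero gam2) A2 B2 ->
     (forall z, inD z ->
        Cadd (Cps A2 z) (Cmul (Cexpi (- 2 * gam2)) (Cps B2 z)) =
        Cdiv z (Csub Cone (Cmul (Cexpi gam2) z))) ->
     convex_in_direction (hfun (hconv A1 A2) (hconv B1 B2)) (- (phi + gam2)))
  /\ (* (2) *)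
    (forall beta, 0 < beta < PI ->
     class_S (Omega0 beta) A2 B2 ->
     (forall z, inD z ->
        Cadd (Cps A2 z) (Cps B2 z) =
        Cmul (Cinv (Cmul (RtoC (2 * sin beta)) Ci))
             (Clog (Cdiv (Cadd Cone (Cmul z (Cexpi beta)))
                         (Cadd Cone (Cmul z (Cexpi (- beta))))))) ->
     convex_in_direction (hfun (hconv A1 A2) (hconv B1 B2)) (- phi)) ).
Proof.
  intros _ _ _ a1' gama phi [[[HA1 [HB1 _]] _] _] Hsum1 Hdil1 Hn [HA2 [HB2 HB20]] _
    Hdil2 [Hlow Hhigh].
  assert (Hn0 : 0 < INR n) by now apply lt_0_INR.
  assert (Hlow' : 2 * INR n <= Cmod (Cadd Cone a1) * (INR n + 2)).
  { apply Rmult_le_compat_r with (r := INR n + 2) in Hlow; [|lra].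
    unfold Rdiv in Hlow. rewrite Rmult_assoc, Rinv_l, Rmult_1_r in Hlow by lra.
    exact Hlow. }
  (* Since [n > 0], the lower bound on the modulus is positive, which gives [-1 < a1']. *)
  assert (Ha : -1 < a1' < 1) by (unfold a1'; split; nra).
  (* This is [2 n <= (1 + a1') (n + 2)] rearranged. *)
  assert (Hbound : (1 - a1') * INR n <= 2 * (1 + a1')) by (unfold a1'; lra).
  split.
  - intros [[_ [HA20 _]] _] Hsum2.
    destruct half_plane_coordinates as [HI [HVD [HV [Hk [HP [Honto HQ]]]]]].
    apply (convolution_convex _ _ _ _ 1 a1' theta phi gam2 n A1 B1 A2 B2
             HI Rlt_0_1 HVD HV Hk HP Honto HQ); try assumption.
    intros z Hz. now apply half_plane_derivative.
  - intros beta Hbeta [[_ [HA20 _]] _] Hsum2.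
    destruct (strip_coordinates beta Hbeta)
      as [HI [Hlam [HVD [HV [Hk [HP [Honto HQ]]]]]]].
    (* The strip is already in normal position, so the second rotation angle is 0. *)
    replace (- phi) with (- (phi + 0)) by ring.
    apply (convolution_convex _ _ _ _ _ a1' theta phi 0 n A1 B1 A2 B2
             HI Hlam HVD HV Hk HP Honto HQ); try assumption.
    intros z Hz. replace (- 2 * 0) with 0 by ring. rewrite Cexpi_0.
    replace (1 * Cps (dps B2) z)%X with (Cps (dps B2) z) by ring.
    replace (1 * z)%X with z by ring.
    now apply strip_log_derivative.
Qed.
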